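(* Let $\overline{C2}(\zeta;q)$ be the second residual crank generating function for overpartitions, and for every integer $s\ge1$ let $\overline{C2}_{2s}(q)$ denote the normalized even ($2s$-th) moment associated with $\overline{C2}(\zeta;q)$. Then for every integer $s\ge1$, $$\overline{C2}_{2s}(q)=\operatorname{Tr}_s\Big(\Psi_T;\ 2G_2(2\tau)+\frac{B_2}{4},\ 2G_4(2\tau)+\frac{B_4}{8},\ \ldots,\ 2G_{2s}(2\tau)+\frac{B_{2s}}{4s}\Big).$$ Moreover, $$G_{2s}(2\tau)=-\frac{B_{2s}}{4s}+\operatorname{Tr}_s\Big(\Psi_V;\ \overline{C2}_2(q),\ \overline{C2}_4(q),\ \ldots,\ \overline{C2}_{2s}(q)\Big).$$
   Context: Here $q=e^{2\pi i\tau}$ with $|q|<1$, $(a;q)_\infty=\prod_{n\ge0}(1-aq^n)$, and $B_k$ denotes the $k$-th Bernoulli number. An overpartition of $n$ is a partition of $n$ in which the first occurrence of each part may be overlined. The crank of a partition is its largest part if it has no part equal to $1$; otherwise it is $\nu-\mu$, where $\mu$ is the number of parts equal to $1$ and $\nu$ is the number of parts larger than $\mu$. The second residual crank of an overpartition is the crank of the partition obtained from its even non-overlined parts after dividing each of them by two. With $\overline{M2}(m;n)$ denoting the number of overpartitions of $n$ with second residual crank $m$, the generating function is (and is taken to be) $$\overline{C2}(\zeta;q)=\sum_{n\ge0}\sum_{m\in\mathbb{Z}}\overline{M2}(m;n)\zeta^mq^n=\frac{(-q;q)_\infty(q^2;q^2)_\infty}{(q;q^2)_\infty(\zeta q^2;q^2)_\infty(q^2/\zeta;q^2)_\infty}.$$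 Normalized moments. For $r\ge0$, $$\overline{C2}_r(q)=\frac{1}{\overline{C2}(1;q)}\sum_{n\ge0}\sum_{m\in\mathbb{Z}}m^r\,\overline{M2}(m;n)q^n.$$ Eisenstein series. For $k\ge1$, $G_{2k}(\tau)=-\frac{B_{2k}}{4k}+\sum_{n\ge1}\sigma_{2k-1}(n)q^n$, where $\sigma_{j}(n)=\sum_{d\mid n}d^{j}$; thus $G_{2k}(2\tau)=-\frac{B_{2k}}{4k}+\sum_{n\ge1}\sigma_{2k-1}(n)q^{2n}$. Partition traces. A partition $\beta$ of $s$ is written $\beta=(1^{m_1},2^{m_2},\ldots,s^{m_s})\vdash s$, where $m_k\ge0$ is the multiplicity of the part $k$, and $\ell(\beta)=m_1+\cdots+m_s$. For a function $\Psi$ on partitions and quantities $F_1,\ldots,F_s$, $$\operatorname{Tr}_s(\Psi;F_1,\ldots,F_s)=\sum_{\beta\vdash s}\Psi(\beta)\prod_{k=1}^sF_k^{m_k}.$$ For $\beta=(1^{m_1},\ldots,s^{m_s})\vdash s$, $$\Psi_T(\beta)=(2s)!\prod_{k=1}^s\frac{2^{m_k}}{m_k!\,((2k)!)^{m_k}},\qquad \Psi_V(\beta)=\frac{(2s)!}{2}(-1)^{\ell(\beta)-1}(\ell(\beta)-1)!\prod_{k=1}^s\frac{1}{m_k!\,((2k)!)^{m_k}}.$$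
   Formalization: In the first identity the k-th trace argument is corrected to G_{2k}(2τ)+B_{2k}/(4k), without the printed factor 2 before G_{2k}; as printed it fails at s=1, where the left side has constant term 0 and the right side −1/12. *)

(* Defs.v *)
From mathcomp Require Import all_boot all_order all_algebra.
From mathcomp Require Import all_classical all_reals all_analysis.
From mathcomp.real_closed Require Export complex.

Set Implicit Arguments.
Unset Strict Implicit.
Unset Printing Implicit Defensive.

Import Order.TTheory GRing.Theory Num.Theory.
Import numFieldNormedType.Exports.

Local Open Scope classical_set_scope.
Local Open Scope ring_scope.

(* [:: B_0; ...; B_(n-1)], from \sum_(k <= n) 'C(n+1, k) B_k = (n == 0)%:R;
   in particular B_1 = -1/2. *)
Fixpoint bernoulli_seq (n : nat) : seq rat :=
  if n is m.+1 then
    let B := bernoulli_seq m in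
    rcons B (((m == 0%N)%:R - \sum_(k < m) 'C(m.+1, k)%:R * B`_k) / m.+1%:R)
  else [::].

Definition bernoulli_num (n : nat) : rat := (bernoulli_seq n.+1)`_n.

Lemma size_bernoulli_seq n : size (bernoulli_seq n) = n.
Proof. by elim: n => //= n IHn; rewrite size_rcons IHn. Qed.

Lemma nth_bernoulli_seq n k :
  (k < n)%N -> (bernoulli_seq n)`_k = bernoulli_num k.
Proof.
elim: n => // n IHn; rewrite ltnS leq_eqVlt => /orP[/eqP-> //|ltkn].
by rewrite /= nth_rcons size_bernoulli_seq ltkn IHn.
Qed.

Lemma sum_bernoulli_num n :
  \sum_(k < n.+1) 'C(n.+1, k)%:R * bernoulli_num k = (n == 0%N)%:R.
Proof.
rewrite big_ord_recr /= {2}/bernoulli_num /= nth_rcons size_bernoulli_seq.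
rewrite ltnn eqxx binSn mulrC divfK ?pnatr_eq0 // addrC.
rewrite [X in _ - X](eq_bigr (fun k : 'I_n => 'C(n.+1, k)%:R * bernoulli_num k)).
  by rewrite subrK.
by move=> k _; rewrite nth_bernoulli_seq.
Qed.

Definition sigma (j n : nat) : nat := (\sum_(d <- divisors n) d ^ j)%N.

Section QSeries.
Variable C : numFieldType.

(* (a; q)_oo *)
Definition qpochhammer (a q : C) : C :=
  limn (fun N => \prod_(0 <= n < N) (1 - a * q ^+ n)).

Definition C2bar (z q : C) : C :=
  qpochhammer (- q) q * qpochhammer (q ^+ 2) (q ^+ 2) /
  (qpochhammer q (q ^+ 2) * qpochhammer (z * q ^+ 2) (q ^+ 2)
    * qpochhammer (q ^+ 2 / z) (q ^+ 2)).

(* M2 m n is the coefficient of z^m q^n in C2bar z q, expanded where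
   |q| < 1 and |q|^2 < |z| < |q|^-2, which is where the product converges and
   its denominator has no zero.  This determines M2.  Taking the product
   expansion, rather than a count of overpartitions, as the definition fixes
   the usual convention for the crank of the partition 1.  The support
   condition is needed because \sum_(m \in [set: int]) is 0 by convention on
   an infinite support. *)
Definition second_residual_crank_coef (M2 : int -> nat -> int) : Prop :=
  (forall n, finite_set [set m | M2 m n != 0]) /\
  forall z q : C, z != 0 -> `|q| < 1 -> `|q| ^+ 2 < `|z| ->
    `|z| * `|q| ^+ 2 < 1 ->
    series (fun n => (\sum_(m \in [set: int]) (M2 m n)%:~R * z ^ m) * q ^+ n)
      @ \oo --> C2bar z q.

Definition crank_moment (M2 : int -> nat -> int) (r n : nat) : int :=
  \sum_(m \in [set: int]) m ^+ r * M2 m n.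

(* normalized by the value at z = 1 *)
Definition C2bar_moment (M2 : int -> nat -> int) (r : nat) (q : C) : C :=
  limn (series (fun n => (crank_moment M2 r n)%:~R * q ^+ n)) / C2bar 1 q.

Definition sigma_series (j : nat) (q : C) : C :=
  limn (series (fun n => (sigma j n.+1)%:R * q ^+ n.+1)).

(* A partition of s, as its multiplicities: for i : 'I_s, m i is the
   multiplicity of the part i.+1. *)
Definition multiplicities (s : nat) := {ffun 'I_s -> 'I_s.+1}.

Definition is_partition_of (s : nat) (m : multiplicities s) : bool :=
  (\sum_(i < s) i.+1 * m i)%N == s.

Definition partition_length (s : nat) (m : multiplicities s) : nat :=
  (\sum_(i < s) m i)%N.

Definition partition_trace (s : nat) (Psi : multiplicities s -> C)
    (F : nat -> C) : C :=
  \sum_(m : multiplicities s | is_partition_of m)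
    Psi m * \prod_(i < s) F i.+1 ^+ m i.

Definition PsiT (s : nat) (m : multiplicities s) : C :=
  (2 * s)`!%:R *
  \prod_(i < s) (2 ^+ m i / ((m i)`!%:R * (2 * i.+1)`!%:R ^+ m i)).

Definition PsiV (s : nat) (m : multiplicities s) : C :=
  (2 * s)`!%:R / 2 * (-1) ^+ (partition_length m).-1 *
  (partition_length m).-1`!%:R *
  \prod_(i < s) ((m i)`!%:R * (2 * i.+1)`!%:R ^+ m i)^-1.

End QSeries.

Section Eisenstein.
Variable R : realType.

Definition cexp (z : R[i]) : R[i] :=
  Complex (expR (complex.Re z) * cos (complex.Im z))
          (expR (complex.Re z) * sin (complex.Im z)).

(* q = e^(2 pi i tau) *)
Definition nome (tau : R[i]) : R[i] := cexp (2 * Complex 0 pi * tau).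

Definition bernoulli_term (k : nat) : R[i] :=
  ratr (bernoulli_num (2 * k)) / (4 * k)%:R.

(* G_(2k), for k >= 1: the argument is half the weight. *)
Definition eisenstein (k : nat) (tau : R[i]) : R[i] :=
  - bernoulli_term k + sigma_series (2 * k - 1) (nome tau).

End Eisenstein.

(* Main.v *)
(* Write Q = q^2 and P_n(z) = \sum_m M2(m, n) z^m. Since
   C2bar(z; q) (zQ; Q)_oo (Q/z; Q)_oo does not depend on z, applying z d/dz
   to its logarithm gives
     z d/dz C2bar = C2bar \sum_(n, m >= 1) (z^m - z^-m) Q^(nm),
   and r further applications of z d/dz at z = 1 turn this into
     M_(r+1) = \sum_j binomial(r, j) (1 - (-1)^j) M_(r-j) S_j(Q),
   where M_r(q) is the generating series of the r-th crank moments and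
   S_j(Q) = \sum_n sigma_j(n) Q^n.  Only odd j contribute, so with
   h_s = M_(2s) / (M_0 (2s)!) and y_k = 2 S_(2k-1)(Q) / (2k)! one gets
   s h_s = \sum_k k y_k h_(s-k), i.e. \sum h_s X^s = exp (\sum y_k X^k); the two
   traces are the coefficients of this exponential and of its logarithm.

   Differentiating in z is legitimate because it is done on coefficients: P_n
   depends only on finitely many factors of the product, up to O(q^(n+1)) as
   q tends to 0, so the recurrence is an identity between Laurent polynomials.
   It also shows inductively that the coefficients of every M_r grow
   subexponentially, which gives convergence for |q| < 1. *)
Require Import Defs.
From mathcomp Require Import all_boot all_order all_algebra.
From mathcomp Require Import all_classical all_reals all_analysis.
From mathcomp Require Import ring lra zify.
Import Order.TTheory GRing.Theory Num.Theory.
Import numFieldNormedType.Exports.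
Import Normc.

Set Implicit Arguments.
Unset Strict Implicit.
Unset Printing Implicit Defensive.

Local Open Scope classical_set_scope.
Local Open Scope ring_scope.

(** * Convergence in R[i] *)

Section ComplexModulus.
Variable R : realType.
Implicit Types (x y z : R[i]) (u v : nat -> R[i]).

Lemma normr_normc x : `|x| = (normc x)%:C%C.
Proof. by []. Qed.

Lemma normc_ge0 x : 0 <= normc x.
Proof. by rewrite -ler0c -normr_normc. Qed.

Lemma normc_eq0 x : (normc x == 0) = (x == 0).
Proof. by apply/eqP/eqP => [/eq0_normc|->]; rewrite ?normc0. Qed.

Lemma normc_gt0 x : (0 < normc x) = (x != 0).
Proof. by rewrite lt_def normc_eq0 normc_ge0 andbT. Qed.

Lemma normcX x n : normc (x ^+ n) = normc x ^+ n.
Proof. by elim: n => [|n IH]; rewrite ?expr0 ?normc1 // !exprS normcM IH. Qed.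

Lemma normc_natr n : normc (n%:R : R[i]) = n%:R.
Proof. by rewrite normcMn normc1. Qed.

Lemma normc_distC x y : normc (x - y) = normc (y - x).
Proof. by rewrite -normcN opprB. Qed.

Lemma normc_sum (I : Type) (r : seq I) (P : pred I) (F : I -> R[i]) :
  normc (\sum_(i <- r | P i) F i) <= \sum_(i <- r | P i) normc (F i).
Proof.
elim/big_rec2: _ => [|i b a _ IH]; first by rewrite normc0.
by apply: le_trans (le_normcD _ _) _; rewrite lerD2l.
Qed.

Lemma normc_prod (I : Type) (r : seq I) (P : pred I) (F : I -> R[i]) :
  normc (\prod_(i <- r | P i) F i) = \prod_(i <- r | P i) normc (F i).
Proof.
elim/big_rec2: _ => [|i b a _ IH]; first by rewrite normc1.
by rewrite normcM IH.
Qed.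

Lemma normc_Re x : `|complex.Re x| <= normc x.
Proof. by rewrite -lecR -normr_normc normc_ge_Re. Qed.

Lemma normc_Im x : `|complex.Im x| <= normc x.
Proof.
case: x => a b /=; rewrite -sqrtr_sqr ler_wsqrtr //.
by rewrite lerDr sqr_ge0.
Qed.

Lemma normc_le_ReIm x : normc x <= `|complex.Re x| + `|complex.Im x|.
Proof.
have -> : x = ((complex.Re x)%:C + (Complex 0 (complex.Im x)))%C.
  by case: x => a b; apply/eqP; rewrite eq_complex /= addr0 add0r !eqxx.
apply: le_trans (le_normcD _ _) _; case: x => a b /=; rewrite add0r addr0.
by rewrite /normc expr0n /= addr0 add0r !sqrtr_sqr.
Qed.

(* The topology of [numFieldNormedType.Exports] is not inferred on R[i] itself,
   only on R[i] seen as a [numFieldType]; [cvg_numP] relates the two. *)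
Definition cvgc u l := (fun n => normc (u n - l)) @ \oo --> (0 : R).

Lemma cvgcP u l : cvgc u l <->
  forall e : R, 0 < e -> \forall n \near \oo, normc (u n - l) < e.
Proof.
split=> [/cvgrPdist_lt h e /h|h].
  apply: filterS => n; by rewrite sub0r normrN ger0_norm ?normc_ge0.
apply/cvgrPdist_lt => e /h.
apply: filterS => n; by rewrite sub0r normrN ger0_norm ?normc_ge0.
Qed.

Definition cvg_num (C : numFieldType) (u : nat -> C) (l : C) := u @ \oo --> l.

Lemma cvg_num_lim (C : numFieldType) (u : nat -> C) (l : C) :
  cvg_num u l -> limn u = l.
Proof. by move=> h; apply: cvg_lim h; exact: norm_hausdorff. Qed.

Lemma cvg_numP u l : cvg_num u l <-> cvgc u l.
Proof.
rewrite cvgcP /cvg_num (cvgrPdist_lt (u : nat -> (R[i] : numFieldType))); split.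
  move=> h e e0; have /h : 0 < e%:C%C :> R[i] by rewrite ltcR.
  by apply: filterS => n; rewrite normc_distC; rewrite normr_normc ltcR.
move=> h e; case: e => e e'; rewrite ltcE /= => /andP[/eqP -> /h].
by apply: filterS => n; rewrite normc_distC normr_normc ltcR.
Qed.

Lemma cvgc_lim u l : cvgc u l -> @lim (R[i] : numFieldType) (u @ \oo) = l.
Proof. by move=> /cvg_numP/cvg_num_lim. Qed.

Lemma cvgc_dominated u l (b : nat -> R) :
  (\forall n \near \oo, normc (u n - l) <= b n) -> b @ \oo --> (0 : R) -> cvgc u l.
Proof.
move=> h b0; apply: (@squeeze_cvgr _ _ _ _ (fun=> 0) b) => //.
  by apply: filterS h => n ->; rewrite normc_ge0.
exact: cvg_cst.
Qed.

Lemma cvgc_cst l : cvgc (fun=> l) l.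
Proof. by apply: (@cvgc_dominated _ _ (fun=> 0)); [near=> n; rewrite subrr normc0|exact: cvg_cst].
Unshelve. all: by end_near. Qed.

Lemma cvgc_unique u l l' : cvgc u l -> cvgc u l' -> l = l'.
Proof. by move=> /cvgc_lim <- /cvgc_lim. Qed.

Lemma cvgc_near_eq u v l : (\forall n \near \oo, u n = v n) -> cvgc u l -> cvgc v l.
Proof.
move=> h hu; apply: cvgc_dominated hu; by apply: filterS h => n ->.
Qed.

Lemma cvgc_eq u v l : u =1 v -> cvgc u l -> cvgc v l.
Proof. by move=> h; apply: cvgc_near_eq; near=> n. Unshelve. all: by end_near. Qed.

Lemma cvgc_comp u l (f : nat -> nat) : (forall n, (n <= f n)%N) ->
  cvgc u l -> cvgc (u \o f) l.
Proof.
move=> hf /cvgcP h; apply/cvgcP => e /h [N _ hN].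
by exists N => // n /= Nn; apply: hN => /=; exact: leq_trans (hf n).
Qed.

Lemma cvgcD u v l l' : cvgc u l -> cvgc v l' -> cvgc (fun n => u n + v n) (l + l').
Proof.
move=> hu hv.
apply: (@cvgc_dominated _ _ (fun n => normc (u n - l) + normc (v n - l'))).
  near=> n; rewrite opprD addrACA; exact: le_normcD.
by rewrite -[0](addr0 0); exact: cvgD.
Unshelve. all: by end_near. Qed.

Lemma cvgcZ a u l : cvgc u l -> cvgc (fun n => a * u n) (a * l).
Proof.
move=> hu.
apply: (@cvgc_dominated _ _ (fun n => normc a * normc (u n - l))).
  near=> n; by rewrite -mulrBr normcM.
by rewrite -[0](mulr0 (normc a)); apply: cvgM => //; exact: cvg_cst.
Unshelve. all: by end_near. Qed.

Lemma cvgcM u v l l' : cvgc u l -> cvgc v l' -> cvgc (fun n => u n * v n) (l * l').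
Proof.
move=> hu hv.
apply: (@cvgc_dominated _ _ (fun n => normc (u n - l) * normc (v n - l') +
    (normc l * normc (v n - l') + normc l' * normc (u n - l)))).
  near=> n; rewrite -!normcM.
  have -> : u n * v n - l * l' =
    (u n - l) * (v n - l') + (l * (v n - l') + l' * (u n - l)) by ring.
  apply: le_trans (le_normcD _ _) _; rewrite lerD2l; exact: le_normcD.
rewrite (_ : 0 = 0 * 0 + (normc l * 0 + normc l' * 0)); last by rewrite !mulr0 !addr0.
by do ![apply: cvgD|apply: cvgM|exact: cvg_cst|exact: hu|exact: hv].
Unshelve. all: by end_near. Qed.

Lemma cvgc_sum (I : Type) (r : seq I) (U : I -> nat -> R[i]) (L : I -> R[i]) :
  (forall i, cvgc (U i) (L i)) ->
  cvgc (fun n => \sum_(i <- r) U i n) (\sum_(i <- r) L i).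
Proof.
move=> h; elim: r => [|i r IH].
  by rewrite big_nil; apply: cvgc_eq (cvgc_cst _) => n; rewrite big_nil.
rewrite big_cons; apply: cvgc_eq (cvgcD (h i) IH) => n; by rewrite big_cons.
Qed.

Lemma cvgc_dist_le u l c (K : R) :
  cvgc u l -> (\forall n \near \oo, normc (u n - c) <= K) -> normc (l - c) <= K.
Proof.
move=> /cvgcP h hK; apply/ler_addgt0Pr => e /h he.
have [n [h1 h2]] : exists n, normc (u n - c) <= K /\ normc (u n - l) < e.
  near (\oo : set_system nat) => n; exists n; split; near: n; [exact: hK|exact: he].
rewrite -(subrKA (u n)) addrC; apply: le_trans (le_normcD _ _) _.
by rewrite lerD // normc_distC ltW.
Unshelve. all: by end_near. Qed.

Lemma cvgc_bounded u l : cvgc u l -> exists2 K : R, 0 < K & forall n, normc (u n) <= K.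
Proof.
move=> h; have h' : (fun n => normc (u n - l)) @ \oo --> (0 : R) := h.
have [M [_ hM]] := cvg_seq_bounded (cvgP _ h').
have M1 : M < `|M| + 1 by rewrite (le_lt_trans (ler_norm _)) // ltrDl.
exists (`|M| + 1 + normc l); first by rewrite ltr_pwDl ?normc_ge0 // ltr_wpDl.
move=> n; rewrite -(subrK l (u n)); apply: le_trans (le_normcD _ _) _.
rewrite lerD2r; have := hM _ M1 n I => /=.
by rewrite ger0_norm ?normc_ge0.
Qed.

Lemma geometric_cvg0 (K r : R) : 0 <= r < 1 ->
  (fun n => K * r ^+ n) @ \oo --> (0 : R).
Proof.
move=> /andP[r0 r1]; rewrite -[0](mulr0 K); apply: cvgM; first exact: cvg_cst.
by apply: cvg_expr; rewrite ger0_norm.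
Qed.

Lemma real_geometric_cauchy (x : nat -> R) (K r : R) : 0 <= r < 1 ->
  (forall n, `|x n.+1 - x n| <= K * r ^+ n) -> cvgn x.
Proof.
move=> /andP[r0 r1] h.
have : cvgn (series (telescope x)).
  apply: normed_cvg; apply: (@series_le_cvg _ _ (geometric K r)) => [n|n|n|].
  - exact: normr_ge0.
  - exact: le_trans (h n).
  - exact: h.
  - by apply: is_cvg_geometric_series; rewrite ger0_norm.
move=> /cvg_ex[/= l hl].
have : (fun n => x 0%N + series (telescope x) n) @ \oo --> x 0%N + l.
  by apply: cvgD; [exact: cvg_cst|exact: hl].
have -> : (fun n => x 0%N + series (telescope x) n) = x.
  by apply/funext => n; rewrite telescopeK addrC subrK.
exact: cvgP.
Qed.

Lemma sum_geometric_le (r : R) m n : 0 <= r < 1 ->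
  \sum_(m <= i < n) r ^+ i <= r ^+ m / (1 - r).
Proof.
move=> /andP[r0 r1]; have r1' : 0 < 1 - r by rewrite subr_gt0.
rewrite ler_pdivlMr // mulrC.
have [nm|mn] := leqP n m; first by rewrite big_geq // mulr0 exprn_ge0.
rewrite (_ : (1 - r) * _ = r ^+ m - r ^+ n) ?gerBl ?exprn_ge0 //.
rewrite mulr_sumr (eq_bigr (fun i => - r ^+ i.+1 - - r ^+ i)); last first.
  by move=> i _; rewrite exprS; ring.
by rewrite (telescope_sumr (fun i => - r ^+ i)) ?(ltnW mn) // opprK addrC.
Qed.

Lemma geometric_dist_le u (K r : R) m n : 0 <= r < 1 -> (m <= n)%N ->
  (forall n, normc (u n.+1 - u n) <= K * r ^+ n) ->
  normc (u n - u m) <= K * r ^+ m / (1 - r).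
Proof.
move=> hr mn h.
rewrite -telescope_sumr //; apply: le_trans (normc_sum _ _ _) _.
apply: (@le_trans _ _ (\sum_(m <= i < n) K * r ^+ i)).
  by apply: ler_sum => i _; exact: h.
have K0 : 0 <= K by have := h 0%N; rewrite expr0 mulr1; apply: le_trans; exact: normc_ge0.
rewrite -mulr_sumr -mulrA; apply: ler_wpM2l => //; exact: sum_geometric_le.
Qed.

(** Completeness is taken from the real line: real and imaginary parts inherit the geometric bound
    on the increments. *)
Lemma cvgc_geometric u (K r : R) : 0 <= r < 1 ->
  (forall n, normc (u n.+1 - u n) <= K * r ^+ n) -> exists l, cvgc u l.
Proof.
move=> hr h.
have /cvg_ex[/= a ha] : cvgn (fun n => complex.Re (u n)).
  apply: (real_geometric_cauchy hr) => n; apply: le_trans (h n).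
  apply: le_trans (normc_Re _); by rewrite raddfB.
have /cvg_ex[/= b hb] : cvgn (fun n => complex.Im (u n)).
  apply: (real_geometric_cauchy hr) => n; apply: le_trans (h n).
  apply: le_trans (normc_Im _); by rewrite raddfB.
exists (Complex a b).
apply: (@cvgc_dominated _ _ (fun n => `|complex.Re (u n) - a| + `|complex.Im (u n) - b|)).
  near=> n; apply: le_trans (normc_le_ReIm _) _; by rewrite !raddfB.
rewrite -[0](addr0 0); apply: cvgD.
  by rewrite -(@normr0 _ R); apply: cvg_norm; rewrite -(subrr a); apply: cvgB => //; exact: cvg_cst.
by rewrite -(@normr0 _ R); apply: cvg_norm; rewrite -(subrr b); apply: cvgB => //; exact: cvg_cst.
Unshelve. all: by end_near. Qed.

Lemma geometric_lim_dist_le u l (K r : R) n : 0 <= r < 1 -> cvgc u l ->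
  (forall n, normc (u n.+1 - u n) <= K * r ^+ n) ->
  normc (l - u n) <= K * r ^+ n / (1 - r).
Proof.
move=> hr hl h; apply: (cvgc_dist_le hl); exists n => // m /= nm.
exact: geometric_dist_le.
Qed.

End ComplexModulus.

(** * Convergence and non-vanishing of infinite q-products *)

Section InfiniteProduct.
Variable R : realType.
Implicit Types (a q : R[i]).

Local Notation poch a q := (fun N => \prod_(0 <= n < N) (1 - a * q ^+ n)).

(** Each factor is at most exp(|a| |q|^n), and the exponents sum to at most |a| / (1 - |q|),
    uniformly in [N]. *)
Lemma normc_finite_poch_le a q N : normc q < 1 ->
  normc (\prod_(0 <= n < N) (1 - a * q ^+ n)) <= expR (normc a / (1 - normc q)).
Proof.
move=> q1; rewrite normc_prod.
apply: (@le_trans _ _ (\prod_(0 <= n < N) expR (normc a * normc q ^+ n))).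
  apply: ler_prod => i _; rewrite normc_ge0 /=.
  apply: le_trans (expR_ge1Dx _); apply: le_trans (le_normcD _ _) _.
  by rewrite normcN normc1 normcM normcX.
rewrite -expR_sum ler_expR -mulr_sumr ler_wpM2l ?normc_ge0 //.
by rewrite -div1r -(expr0 (normc q)) sum_geometric_le // normc_ge0.
Qed.

Lemma finite_poch_step_le a q n : normc q < 1 ->
  normc (poch a q n.+1 - poch a q n) <=
  expR (normc a / (1 - normc q)) * normc a * normc q ^+ n.
Proof.
move=> q1 /=; rewrite big_nat_recr //= mulrBr mulr1 addrC addKr normcN.
rewrite !normcM normcX -mulrA ler_wpM2r ?normc_finite_poch_le //.
by rewrite mulr_ge0 ?exprn_ge0 ?normc_ge0.
Qed.

Lemma cvgc_qpochhammer a q : normc q < 1 -> cvgc (poch a q) (qpochhammer a q).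
Proof.
move=> q1; have hr : 0 <= normc q < 1 by rewrite normc_ge0.
have [l hl] := cvgc_geometric hr (fun n => finite_poch_step_le a n q1).
by rewrite (_ : qpochhammer a q = l) //; exact: cvgc_lim.
Qed.

Lemma qpochhammer_dist_le a q N : normc q < 1 ->
  normc (qpochhammer a q - poch a q N) <=
  expR (normc a / (1 - normc q)) * normc a * normc q ^+ N / (1 - normc q).
Proof.
move=> q1; apply: geometric_lim_dist_le; first by rewrite normc_ge0.
  exact: cvgc_qpochhammer.
by move=> n; exact: finite_poch_step_le.
Qed.

Lemma qpochhammer_split a q N : normc q < 1 ->
  qpochhammer a q = poch a q N * qpochhammer (a * q ^+ N) q.
Proof.
move=> q1; apply: (@cvgc_unique _ (fun n => poch a q (N + n)%N)).
  apply: (@cvgc_comp _ (poch a q) _ (fun n => (N + n)%N)); last exact: cvgc_qpochhammer.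
  by move=> n; exact: leq_addl.
apply: cvgc_eq (cvgcZ (poch a q N) (cvgc_qpochhammer (a * q ^+ N) q1)) => n.
rewrite [RHS](@big_cat_nat _ _ _ N) //= ?leq_addr //; congr (_ * _).
rewrite [RHS](_ : _ = \prod_(0 + N <= i < N + n) (1 - a * q ^+ i)) ?add0n // -{2}(add0n N) big_addn addKn; apply: eq_bigr => i _.
by rewrite -mulrA -exprD [(N + i)%N]addnC.
Qed.

(** For large N the tail product, with a q^N in place of a, differs from its empty partial product 1
    by less than 1 and so cannot vanish; the finitely many factors in front are nonzero by
    hypothesis. *)
Lemma qpochhammer_neq0 a q : normc q < 1 -> (forall n, 1 - a * q ^+ n != 0) ->
  qpochhammer a q != 0.
Proof.
move=> q1 h; have hr : 0 <= normc q < 1 by rewrite normc_ge0.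
(* K |q|^N bounds that difference: replacing a by a q^N extracts a factor |q|^N and can only shrink
   the exponential. *)
set K := expR (normc a / (1 - normc q)) * normc a / (1 - normc q).
have /cvgrPdist_lt/(_ _ ltr01)[N _ hN] := geometric_cvg0 K hr.
have {}hN : K * normc q ^+ N < 1.
  have := hN N (leqnn N); rewrite sub0r normrN; apply: le_lt_trans; exact: ler_norm.
rewrite (qpochhammer_split _ N) // mulf_neq0 //.
  by rewrite prodf_seq_neq0; apply/allP => i _; exact: h.
apply/eqP => h0; have := qpochhammer_dist_le (a * q ^+ N) 0 q1.
rewrite h0 big_geq // sub0r normcN normc1 leNgt => /negP; apply.
apply: le_lt_trans hN; rewrite expr0 mulr1 normcM normcX /K.
rewrite [leRHS]mulrAC ler_pM2r ?invr_gt0 ?subr_gt0 // mulrA ler_wpM2r ?exprn_ge0 ?normc_ge0 //.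
rewrite ler_wpM2r ?normc_ge0 // ler_expR ler_pM2r ?invr_gt0 ?subr_gt0 //.
by rewrite ler_piMr ?normc_ge0 // exprn_ile1 ?normc_ge0 // ltW.
Qed.

End InfiniteProduct.

(** * Truncated power series and partition traces *)

Section TruncatedEquality.
Variable A : comNzRingType.
Implicit Types (p q r t : {poly A}).

Definition eqmodX N p q := forall k, (k < N)%N -> p`_k = q`_k.

Lemma eqmodX_refl N p : eqmodX N p p.
Proof. by []. Qed.

Lemma eqmodX_sym N p q : eqmodX N p q -> eqmodX N q p.
Proof. by move=> h k kN; rewrite h. Qed.

Lemma eqmodX_trans N p q r : eqmodX N p q -> eqmodX N q r -> eqmodX N p r.
Proof. by move=> h h' k kN; rewrite h ?h'. Qed.

Lemma eqmodXD N p q r t : eqmodX N p q -> eqmodX N r t -> eqmodX N (p + r) (q + t).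
Proof. by move=> h h' k kN; rewrite !coefD h ?h'. Qed.

Lemma eqmodXN N p q : eqmodX N p q -> eqmodX N (- p) (- q).
Proof. by move=> h k kN; rewrite !coefN h. Qed.

Lemma eqmodXM N p q r t : eqmodX N p q -> eqmodX N r t -> eqmodX N (p * r) (q * t).
Proof.
move=> h h' k kN; rewrite !coefM; apply: eq_bigr => i _.
by rewrite h ?h' // (leq_ltn_trans _ kN) ?leq_subr // -ltnS.
Qed.

Lemma eqmodXMl N p q r : eqmodX N p q -> eqmodX N (r * p) (r * q).
Proof. exact: eqmodXM. Qed.

Lemma eqmodXMn N n p q : eqmodX N p q -> eqmodX N (p *+ n) (q *+ n).
Proof. by move=> h k kN; rewrite !coefMn h. Qed.

Lemma eqmodX0M a b p q : eqmodX a p 0 -> eqmodX b q 0 -> eqmodX (a + b) (p * q) 0.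
Proof.
move=> hp hq k kab; rewrite coef0 coefM big1 // => i _.
have [ia|ai] := ltnP i a; first by rewrite hp // coef0 mul0r.
by rewrite hq ?coef0 ?mulr0 // ltn_subLR 1?(leq_trans kab) ?leq_add2r // -ltnS.
Qed.

Lemma eqmodX0X p n : p`_0 = 0 -> eqmodX n (p ^+ n) 0.
Proof.
move=> p0; elim: n => [|n IH]; first by [].
rewrite exprS -add1n; apply: eqmodX0M IH => -[|//] _; by rewrite p0 coef0.
Qed.

Lemma coefXderiv p k : ('X * p^`())`_k = p`_k *+ k.
Proof. by case: k => [|k]; rewrite coefXM ?mulr0n //= coef_deriv. Qed.

End TruncatedEquality.

(** Induction on the degree of the coefficient. An integral domain suffices, which matters because
    the constant coefficient of [theta_prod] below is a power of z, nonzero but in general not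
    invertible. *)
Lemma eqmodX_mulfI (A : idomainType) N (g p q : {poly A}) : g`_0 != 0 ->
  eqmodX N (g * p) (g * q) -> eqmodX N p q.
Proof.
move=> g0 h k; elim/ltn_ind: k => k IH kN.
have := h k kN; rewrite !coefM !big_ord_recl /= !subn0.
rewrite [X in _ + X = _](eq_bigr (fun i : 'I_k => g`_(bump 0 i) * q`_(k - bump 0 i))).
  by move=> /addIr /(mulfI g0).
move=> i _; rewrite IH // ?(leq_ltn_trans (leq_subr _ _) kN) //.
by rewrite /bump leq0n ltn_subrL /= (leq_ltn_trans _ (ltn_ord i)).
Qed.

(** * Partition traces as coefficients of exponentials and logarithms *)

Section PartitionTraces.
Variable F : numFieldType.

(* The outer variable of {poly {poly F}} keeps track of the number of parts. *)
Lemma coef_prod_truncated_exp (s l : nat) (I : Type) (r : seq I) (a : I -> {poly F}) :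
  (l <= s)%N ->
  (\prod_(i <- r) \poly_(j < s.+1) ((j`!%:R : F)^-1 *: a i ^+ j))`_l =
  (l`!%:R : F)^-1 *: (\sum_(i <- r) a i) ^+ l.
Proof.
elim: r l => [|i r IH] l ls.
  rewrite !big_nil coef1 expr0n; case: l ls => [|l] _; first by rewrite invr1 scale1r.
  by rewrite scaler0.
rewrite !big_cons coefM addrC exprDn scaler_sumr; apply: eq_bigr => j _.
have jl : (j <= l)%N by rewrite -ltnS.
rewrite coef_poly (leq_ltn_trans jl) ?ltnS // IH ?(leq_trans (leq_subr _ _)) //.
have fn0 n : n`!%:R != 0 :> F by rewrite pnatr_eq0 -lt0n fact_gt0.
have e : (j`!%:R : F)^-1 * (l - j)`!%:R^-1 = l`!%:R^-1 * 'C(l, j)%:R.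
  apply: (mulfI (fn0 l)); rewrite mulVKf // -(bin_fact jl) !natrM.
  by field; rewrite !fn0.
by rewrite -[_ *+ 'C(l, j)](@scaler_nat F) -scalerAl -scalerAr !scalerA e [a i ^+ j * _]mulrC.
Qed.

(** The weight [w] sees a partition only through its length l, and the multinomial expansion of the
    l-th power collects the partitions with l parts. Constant weight 1 gives an exponential, weight
    (-1)^(l-1) (l-1)! a logarithm. *)
Lemma trace_coef (s : nat) (w a : nat -> F) :
  \sum_(m : multiplicities s | is_partition_of m)
     w (partition_length m) * \prod_(i < s) (a i.+1 ^+ m i / (m i)`!%:R) =
  (\sum_(l < s.+1) (w l / l`!%:R) *: (\sum_(i < s) a i.+1 *: 'X^(i.+1)) ^+ l)`_s.
Proof.
pose wt (m : multiplicities s) := (\sum_(i < s) i.+1 * m i)%N.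
pose c (m : multiplicities s) := \prod_(i < s) (a i.+1 ^+ m i / (m i)`!%:R).
have key l : (l <= s)%N ->
    ((l`!%:R : F)^-1 *: (\sum_(i < s) a i.+1 *: 'X^(i.+1)) ^+ l)`_s =
    \sum_(m : multiplicities s) ((partition_length m == l) && (wt m == s))%:R * c m.
  move=> ls; rewrite -(coef_prod_truncated_exp _ _ ls).
  under eq_bigr do rewrite poly_def.
  rewrite bigA_distr_bigA /= coef_sum coef_sum; apply: eq_bigr => m _.
  have -> : \prod_(i < s) (((m i)`!%:R : F)^-1 *: (a i.+1 *: 'X^(i.+1)) ^+ m i *: 'X^(m i))
      = (c m *: 'X^(wt m)) *: 'X^(partition_length m) :> {poly {poly F}}.
    rewrite scaler_prod -expr_sum; congr (_ *: _).
    rewrite /c /wt expr_sum -scaler_prod; apply: eq_bigr => i _.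
    by rewrite exprZn scalerA mulrC -exprM.
  rewrite coefZ coefXn [l == _]eq_sym; case: eqVneq => [_|ne]; last first.
    by rewrite mulr0 coef0 mul0r.
  by rewrite mulr1 coefZ coefXn eq_sym mulrC.
rewrite coef_sum.
transitivity (\sum_(l < s.+1) \sum_(m : multiplicities s)
    w l * (((partition_length m == l) && (wt m == s))%:R * c m)); last first.
  apply: eq_bigr => l _; rewrite -mulr_sumr -key; last by rewrite -ltnS.
  by rewrite -scalerA !coefZ.
rewrite exchange_big /= big_mkcond /=; apply: eq_bigr => m _.
rewrite /is_partition_of -/(wt m).
have [wm|ne] := eqVneq; last by rewrite big1 // => l _; rewrite andbF mul0r mulr0.
(* Every part is at least 1, so a partition of [s] has at most [s] parts and its length is one of
   the indices l. *)
have lm : (partition_length m < s.+1)%N.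
  rewrite ltnS (leq_trans _ (eq_leq wm)) // leq_sum // => i _; exact: leq_pmull.
rewrite (bigD1 (Ordinal lm)) //= eqxx mul1r [X in _ + X]big1 ?addr0 // => l ne.
rewrite (_ : _ == _ = false) ?mul0r ?mulr0 //; apply/negbTE; apply: contraNneq ne => e.
by apply/eqP/val_inj.
Qed.

Variables (h y : nat -> F).
Hypothesis h0 : h 0 = 1.
Hypothesis hrec : forall n, h n.+1 *+ n.+1 = \sum_(k < n.+1) (y k.+1 *+ k.+1) * h (n - k).

Let gen (s : nat) (a : nat -> F) := \sum_(i < s) a i.+1 *: 'X^(i.+1) : {poly F}.

Lemma coef_gen s a k : (gen s a)`_k = if (0 < k <= s)%N then a k else 0.
Proof.
rewrite coef_sum; case: k => [|k].
  by rewrite big1 // => i _; rewrite coefZ coefXn mulr0.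
have [ks|sk] /= := ltnP k s; last first.
  rewrite big1 // => i _; rewrite coefZ coefXn eqSS gtn_eqF ?mulr0 //.
  exact: leq_trans sk.
rewrite (bigD1 (Ordinal ks)) //= coefZ coefXn eqxx mulr1 big1 ?addr0 // => i ne.
rewrite coefZ coefXn eqSS eq_sym (_ : _ == _ = false) ?mulr0 //.
by apply/negbTE; apply: contraNneq ne => e; apply/eqP/val_inj.
Qed.

(** The recurrence [hrec] in generating form: the differential equation of 1 + H = exp(Y). Using X
    d/dX in place of d/dX avoids an index shift. *)
Lemma genh_ode s : eqmodX s.+1 ('X * (gen s h)^`()) ('X * (gen s y)^`() * (1 + gen s h)).
Proof.
move=> [|k] kN; first by rewrite coefXderiv coef0M coefXderiv !mulr0n mul0r.
rewrite coefXderiv coef_gen /= -ltnS kN hrec coefM [RHS]big_ord_recl coefXderiv mulr0n mul0r add0r.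
apply: eq_bigr => i _; rewrite coefXderiv coef_gen lift0 /= coefD coef1 coef_gen subSS.
have ik := ltn_ord i; rewrite (leq_trans ik kN); congr (_ * _).
have ks : (k - i <= s)%N by rewrite (leq_trans (leq_subr _ _)) // ltnW.
by case: (k - i)%N ks => [|j] /= ks; rewrite ?h0 ?addr0 ?ks ?add0r.
Qed.

(** As D has no constant term, each coefficient of D p involves only lower coefficients of p; in
    characteristic 0 the factor k + 1 coming from the derivative can be cancelled. *)
Lemma linear_ode_unique N (D p q : {poly F}) : D`_0 = 0 -> p`_0 = q`_0 ->
  eqmodX N ('X * p^`()) (D * p) -> eqmodX N ('X * q^`()) (D * q) -> eqmodX N p q.
Proof.
move=> D0 pq0 hp hq k; elim/ltn_ind: k => -[//|k] IH kN.
have := hp _ kN; have := hq _ kN; rewrite !coefXderiv !coefM !(@big_ord_recl _ _ _ k.+1) D0 !mul0r !add0r.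
move=> eq_q eq_p; apply/(@mulIf _ k.+1%:R); first by rewrite pnatr_eq0.
rewrite !mulr_natr eq_p eq_q. apply: eq_bigr => i _; rewrite IH ?lift0 ?subSS //.
  by rewrite ltnS leq_subr.
by rewrite (leq_ltn_trans _ kN) // (leq_trans (leq_subr _ _)).
Qed.

(** The truncated exponential of Y and 1 + H solve the same equation with the same constant term,
    hence agree up to degree [s]. *)
Lemma trace_exp s :
  \sum_(m : multiplicities s | is_partition_of m)
     \prod_(i < s) (y i.+1 ^+ m i / (m i)`!%:R) = h s.
Proof.
under eq_bigr do rewrite -[\prod_(_ < _) _]mul1r.
rewrite (trace_coef _ (fun=> 1)) -/(gen s y); set Y := gen s y.
have Y0 : Y`_0 = 0 by rewrite coef_gen.
set E := \sum_(l < s.+1) _.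
have E0 : E`_0 = 1.
  rewrite coef_sum big_ord_recl big1 ?addr0 => [|i _].
    by rewrite coefZ expr0 coef1 invr1 !mulr1.
  by rewrite coefZ lift0 exprS coef0M Y0 mul0r mulr0.
have XE : eqmodX s.+1 ('X * E^`()) ('X * Y^`() * E).
  (* Differentiation lowers the powers of Y, so the top term Y^s / s! is missing from X E'. On the
     right it appears multiplied by X Y' and vanishes modulo X^(s+1), since neither Y nor X Y' has a
     constant term. *)
  rewrite /E [X in eqmodX _ _ (_ * X)]big_ord_recr /= mulrDr.
  apply: (@eqmodX_trans _ _ _ ('X * Y^`() * \sum_(l < s) (1 / l`!%:R) *: Y ^+ l + 0)).
    rewrite addr0 raddf_sum big_ord_recl /= expr0 derivZ derivC scaler0 add0r !mulr_sumr.
    suff -> : \sum_(i < s) 'X * ((1 / (lift ord0 i)`!%:R) *: Y ^+ lift ord0 i)^`() =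
        \sum_(i < s) 'X * Y^`() * ((1 / i`!%:R) *: Y ^+ i) by exact: eqmodX_refl.
    apply: eq_bigr => i _. rewrite ?lift0 derivZ deriv_exp /= -mulrA; congr (_ * _).
    rewrite -[_ *+ i.+1](@scaler_nat F) scalerA -scalerAr; congr (_ *: _).
    have f0 : (i`!%:R : F) != 0 by rewrite pnatr_eq0 -lt0n fact_gt0.
    have n0 : (i.+1%:R : F) != 0 by rewrite pnatr_eq0.
    by rewrite factS natrM; move: (i`!%:R) (i.+1%:R) f0 n0 => x z x0 z0; field; rewrite ?x0 ?z0.
  apply: eqmodXD; first exact: eqmodX_refl.
  rewrite -scalerAr -mul_polyC; apply: eqmodX_sym => k kN; rewrite coefCM.
  rewrite (@eqmodX0M _ 1 s _ _ _ (eqmodX0X (n := s) Y0)) ?coef0 ?mulr0 //.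
  by move=> [|//] _; rewrite coefXderiv mulr0n coef0.
have XH := @genh_ode s.
have H0 : (1 + gen s h)`_0 = 1 by rewrite coefD coef1 coef_gen addr0.
have <- : (1 + gen s h)`_s = h s.
  rewrite coefD coef1 coef_gen leqnn andbT.
  by case: (s) => [|n]; rewrite /= ?h0 ?addr0 ?add0r.
apply: (@linear_ode_unique s.+1 ('X * Y^`())) => //.
- by rewrite coefXderiv mulr0n.
- by rewrite E0 H0.
- by rewrite derivD derivC add0r.
Qed.

(** For L the truncated logarithm of 1 + H, summing a geometric progression gives (1 + H) X L' = X
    H' (1 - (-H)^s). The term in H^s is negligible, [genh_ode] rewrites X H' as X Y' (1 + H), and 1
    + H cancels. *)
Lemma trace_log s : (0 < s)%N ->
  \sum_(m : multiplicities s | is_partition_of m)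
     ((-1) ^+ (partition_length m).-1 * (partition_length m).-1`!%:R) *
     \prod_(i < s) (h i.+1 ^+ m i / (m i)`!%:R) = y s.
Proof.
move=> s0.
(* At l = 0 the truncated predecessor would give weight 1, whereas a logarithm has no constant term.
   The extra factor removes it, and no partition of [s > 0] has length 0. *)
pose w l : F := (l != 0%N)%:R * ((-1) ^+ l.-1 * l.-1`!%:R).
transitivity (\sum_(m : multiplicities s | is_partition_of m)
     w (partition_length m) * \prod_(i < s) (h i.+1 ^+ m i / (m i)`!%:R)).
  apply: eq_bigr => m pm; rewrite /w (_ : partition_length m != 0%N) ?mul1r //.
  apply: contraTneq pm => /eqP; rewrite /partition_length sum_nat_eq0 => /forallP m0.
  rewrite /is_partition_of big1 ?(ltn_eqF s0) // => i _.
  by have /eqP -> := m0 i; rewrite muln0.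
rewrite trace_coef -/(gen s h); set H := gen s h.
have H0 : H`_0 = 0 by rewrite coef_gen.
set L := \sum_(l < s.+1) _.
have XL : 'X * L^`() = 'X * H^`() * \sum_(l < s) (- H) ^+ l.
  rewrite raddf_sum big_ord_recl /= /w eqxx !mul0r scale0r linear0 add0r !mulr_sumr.
  apply: eq_bigr => i _. rewrite ?lift0 derivZ deriv_exp /= -mulrA; congr (_ * _).
  rewrite /= -[_ *+ i.+1](@scaler_nat F) scalerA (_ : (- H) ^+ i = ((-1 : F) ^+ i) *: H ^+ i); last by rewrite -exprZn scaleN1r.
  rewrite -[RHS]scalerAr add0n; congr (_ *: _).
  have f0 : (i`!%:R : F) != 0 by rewrite pnatr_eq0 -lt0n fact_gt0.
  have n0 : (i.+1%:R : F) != 0 by rewrite pnatr_eq0.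
  by rewrite factS natrM; move: (i`!%:R) (i.+1%:R) f0 n0 => x z x0 z0; field; rewrite ?x0 ?z0.
have XLY : eqmodX s.+1 ('X * L^`()) ('X * (gen s y)^`()).
  apply: (@eqmodX_mulfI _ _ (1 + H)); first by rewrite coefD coef1 H0 addr0 oner_eq0.
  rewrite [X in eqmodX _ _ X]mulrC; apply: (eqmodX_trans _ (@genh_ode s)).
  rewrite XL [(1 + H) * _]mulrC -(mulrA _ _ (1 + H)).
  have -> : (\sum_(l < s) (- H) ^+ l) * (1 + H) = 1 - (- H) ^+ s.
    by rewrite mulrC -[1 - _]opprB subrX1 -mulNr; congr (_ * _); ring.
  rewrite mulrBr mulr1 -[X in eqmodX _ _ X]addr0; apply: eqmodXD; first exact: eqmodX_refl.
  rewrite -[0 in X in eqmodX _ _ X]oppr0; apply: eqmodXN.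
  rewrite -add1n; apply: eqmodX0M; first by move=> [|//] _; rewrite coefXderiv mulr0n coef0.
  by apply: eqmodX0X; rewrite coefN H0 oppr0.
have := XLY s (ltnSn s); rewrite !coefXderiv coef_gen s0 leqnn /=.
by move=> e; apply: (@mulIf _ s%:R); rewrite ?mulr_natr // pnatr_eq0 -lt0n.
Qed.

End PartitionTraces.

(** * The logarithmic derivative in the crank variable *)

(* Elements of {poly {poly F}} are polynomials in q over polynomials in z. *)
Section BivariateLogDerivative.
Variable F : numFieldType.
Implicit Types (U V W : {poly {poly F}}).

Definition dz W : {poly {poly F}} := map_poly (@deriv F) W.

Lemma coef_dz W k : (dz W)`_k = (W`_k)^`().
Proof. by rewrite coef_map_id0 // deriv0. Qed.

Lemma dzD U V : dz (U + V) = dz U + dz V.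
Proof. by apply/polyP => k; rewrite coefD !coef_dz coefD derivD. Qed.

Lemma dzN U : dz (- U) = - dz U.
Proof. by apply/polyP => k; rewrite coefN !coef_dz coefN derivN. Qed.

Lemma dzM U V : dz (U * V) = dz U * V + U * dz V.
Proof.
apply/polyP => k; rewrite coefD coef_dz !coefM raddf_sum /= -big_split /=.
by apply: eq_bigr => i _; rewrite derivM !coef_dz.
Qed.

Lemma dzC (p : {poly F}) : dz p%:P = (p^`())%:P.
Proof. by apply/polyP => k; rewrite coef_dz !coefC; case: eqP => //; rewrite deriv0. Qed.

Lemma dz_map_polyC (p : {poly F}) : dz (map_poly polyC p) = 0.
Proof. by apply/polyP => k; rewrite coef_dz coef_map /= derivC coef0. Qed.

Lemma dzXn n : dz 'X^n = 0.
Proof. by rewrite -(map_polyXn polyC) dz_map_polyC. Qed.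

Lemma eqmodX_dz N U V : eqmodX N U V -> eqmodX N (dz U) (dz V).
Proof. by move=> h k kN; rewrite !coef_dz h. Qed.

Let z : {poly {poly F}} := ('X)%:P.

Lemma dz_z : dz z = 1.
Proof. by rewrite dzC derivX. Qed.

Lemma dz_zX n : dz (z ^+ n) = z ^+ n.-1 *+ n.
Proof. by rewrite -rmorphXn /= dzC derivXn polyCMn rmorphXn. Qed.

(* z times (1 - z q^n) (1 - q^n / z), so as to stay within polynomials in z. *)
Definition theta_factor n : {poly {poly F}} := (1 - z * 'X^n) * (z - 'X^n).

Definition theta_prod L := \prod_(i < L) theta_factor (2 * i.+1).

(** This is z^N times the sum of (z^m - z^-m) q^(nm) over 1 <= m <= N, cleared of negative powers of
    z. *)
Definition lambert_sum N n : {poly {poly F}} :=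
  \sum_(1 <= m < N.+1) 'X^n ^+ m * (z ^+ (N + m) - z ^+ (N - m)).

(** Subtracting [theta_factor n] compensates its extra factor z. With Y = q^n, what remains is the
    factor times -zY/(1 - zY) + (Y/z)/(1 - Y/z). Expanding both geometric series up to m = N leaves
    errors divisible by Y^(N+1), which vanish modulo q^(N+1) as n > 0. *)
Lemma theta_factor_log_derivative N n : (0 < n)%N ->
  eqmodX N.+1 (z ^+ N * (z * dz (theta_factor n) - theta_factor n))
              (- lambert_sum N n * theta_factor n).
Proof.
move=> n0; set Y : {poly {poly F}} := 'X^n.
have YN : eqmodX N.+1 (Y ^+ N.+1) 0.
  by apply: eqmodX0X; rewrite coefXn eq_sym -(prednK n0).
have dY : dz Y = 0 by exact: dzXn.
have sumA : (\sum_(1 <= m < N.+1) Y ^+ m * z ^+ (N + m)) * (1 - z * Y) =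
    Y * z ^+ N.+1 - Y ^+ N.+1 * z ^+ (N + N.+1).
  rewrite mulr_suml (eq_bigr (fun m => - (Y ^+ m.+1 * z ^+ (N + m.+1)) - - (Y ^+ m * z ^+ (N + m)))).
    rewrite (telescope_sumr (fun m => - (Y ^+ m * z ^+ (N + m)))) //.
    by rewrite expr1 addn1 opprK addrC.
  by move=> m _; rewrite addnS !exprS; ring.
have sumB : (\sum_(1 <= m < N.+1) Y ^+ m * z ^+ (N - m)) * (z - Y) =
    Y * z ^+ N - Y ^+ N.+1.
  rewrite mulr_suml (eq_big_nat _ _ (F2 := fun m => - (Y ^+ m.+1 * z ^+ (N.+1 - m.+1)) - - (Y ^+ m * z ^+ (N.+1 - m)))).
    rewrite (telescope_sumr (fun m => - (Y ^+ m * z ^+ (N.+1 - m)))) //.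
    by rewrite subnn expr0 mulr1 expr1 subn1 /= opprK addrC.
  by move=> m /andP[_ mN]; rewrite subSS subSn // !exprS; ring.
have -> : z * dz (theta_factor n) - theta_factor n = - (z * Y * (z - Y) - Y * (1 - z * Y)).
  rewrite /theta_factor -/Y dzM !dzD !dzN dzM dY -(polyC1 {poly F}) dzC derivC dz_z; ring.
rewrite mulNr (_ : lambert_sum N n * theta_factor n =
   z ^+ N * (z * Y * (z - Y) - Y * (1 - z * Y)) +
   Y ^+ N.+1 * ((1 - z * Y) - z ^+ (N + N.+1) * (z - Y))); last first.
  rewrite /theta_factor -/Y.
  have -> : lambert_sum N n = \sum_(1 <= m < N.+1) Y ^+ m * z ^+ (N + m)
     - \sum_(1 <= m < N.+1) Y ^+ m * z ^+ (N - m).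
    by rewrite -sumrB; apply: eq_bigr => m _; rewrite mulrBr.
  have alg1 (A : comPzRingType) (a b u v : A) : (a - b) * (u * v) = a * u * v - b * v * u by ring.
  rewrite alg1 sumA sumB exprS; ring.
rewrite -[X in eqmodX _ X]addr0 mulrN opprD; apply: eqmodXD; first exact: eqmodX_refl.
rewrite -[0]oppr0; apply: eqmodXN; apply: eqmodX_sym.
by rewrite -[X in eqmodX _ _ X](mul0r ((1 - z * Y) - z ^+ (N + N.+1) * (z - Y))); apply: eqmodXM.
Qed.

Lemma theta_prod_log_derivative N L :
  eqmodX N.+1 (z ^+ N * (z * dz (theta_prod L) - theta_prod L * L%:R))
    (- (\sum_(i < L) lambert_sum N (2 * i.+1)) * theta_prod L).
Proof.
elim: L => [|L IH].
  rewrite /theta_prod !big_ord0 -(polyC1 {poly F}) dzC derivC mulr0 mulr0 subr0 mulr0 oppr0 mul0r.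
  exact: eqmodX_refl.
rewrite /theta_prod !big_ord_recr /= -/(theta_prod L).
set G := theta_prod L in IH *; set g := theta_factor _.
have Hg : eqmodX N.+1 (z ^+ N * (z * dz g - g)) (- lambert_sum N (2 * L.+1) * g).
  exact: theta_factor_log_derivative.
set T := \sum_(i < L) _ in IH *; set t := lambert_sum _ _ in Hg *.
clearbody G g T t.
have -> : z ^+ N * (z * dz (G * g) - (G * g) * L.+1%:R) =
  z ^+ N * (z * dz G - G * L%:R) * g + z ^+ N * (z * dz g - g) * G.
  have alg (A : comPzRingType) (x w u v a b l : A) :
    w * (x * (a * v + u * b) - u * v * (1 + l)) =
    w * (x * a - u * l) * v + w * (x * b - v) * u by ring.
  by rewrite dzM -nat1r alg.
have alg (A : comPzRingType) (x y u v : A) : - (x + y) * (u * v) = - x * u * v + - y * v * u by ring.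
rewrite alg.
by apply: eqmodXD; apply: eqmodXM.
Qed.

Lemma coef0_theta_prod L : (theta_prod L)`_0 != 0.
Proof.
rewrite -horner_coef0 horner_prod prodf_seq_neq0; apply/allP => i _ /=.
by rewrite /theta_factor !hornerE expr0n /= mulr0 !subr0 mul1r polyX_eq0.
Qed.

(** As P G is z^(K+N) times a factor free of z, the logarithmic derivatives of P and G add up to K +
    N. That of G is N - T / z^N, so that of P is K + T / z^N. Divisions are avoided by multiplying
    through by G and cancelling it at the end. *)
Lemma log_derivative_quotient N K (P G T H : {poly {poly F}}) : dz H = 0 -> G`_0 != 0 ->
  eqmodX N.+1 (z ^+ N * (z * dz G - G * N%:R)) (- T * G) ->
  eqmodX N.+1 (P * G) (z ^+ (K + N) * H) ->
  eqmodX N.+1 (z ^+ N * (z * dz P - P * K%:R)) (T * P).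
Proof.
move=> H0 G0 hG hP.
have hd : eqmodX N.+1 (z * (dz P * G + P * dz G)) (P * G * (K + N)%:R).
  rewrite -dzM; apply: (@eqmodX_trans _ _ _ (z * dz (z ^+ (K + N) * H))).
    by apply: eqmodXMl; apply: eqmodX_dz.
  rewrite dzM H0 mulr0 addr0 dz_zX mulr_natr.
  rewrite mulrnAl mulrnAr mulrA -exprS.
  case: (K + N)%N hP => [|j] hP /=; first by rewrite !mulr0n.
  by apply: eqmodXMn; exact: eqmodX_sym.
apply: (@eqmodX_mulfI _ _ G) => //.
have alg1 (A : comPzRingType) (x w u v a b l k : A) :
  u * (w * (x * a - v * k)) = w * (x * (a * u + v * b)) - w * (v * u * (k + l))
    - v * (w * (x * b - u * l)) by ring.
have alg2 (A : comPzRingType) (x u v t : A) : u * (t * v) = x - x - v * (- t * u) by ring.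
rewrite (alg1 _ z (z ^+ N) G P (dz P) (dz G) N%:R) -natrD.
rewrite (alg2 _ (z ^+ N * (P * G * (K + N)%:R)) G P T).
apply: eqmodXD; last by apply: eqmodXN; apply: eqmodXMl.
by apply: eqmodXD; [apply: eqmodXMl|exact: eqmodX_refl].
Qed.

(** A single [N] serves as truncation order in q, number of theta factors and bound on m in the
    Lambert sums: later factors and terms do not reach q^N. *)
Lemma coef_log_derivative N K (p : nat -> {poly F}) (H : {poly F}) :
  eqmodX N.+1 ((\poly_(i < N.+1) p i) * theta_prod N)
    (z ^+ (K + N) * map_poly polyC H) ->
  'X^N * ('X * (p N)^`() - p N *+ K) =
  \sum_(i < N.+1) (\sum_(a < N) lambert_sum N (2 * a.+1))`_i * p (N - i)%N.
Proof.
move=> hP.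
have := log_derivative_quotient (dz_map_polyC H) (coef0_theta_prod N)
  (@theta_prod_log_derivative N N) hP (ltnSn N).
have -> : z ^+ N = ('X^N)%:P by rewrite rmorphXn.
rewrite !coefCM coefB coefCM mulr_natr coefMn coef_dz coef_poly ltnSn => ->.
rewrite coefM; apply: eq_bigr => i _; congr (_ * _).
by rewrite coef_poly ltnS leq_subr.
Qed.

Lemma coef_lambert_sum N n i :
  (lambert_sum N n)`_i =
  \sum_(1 <= m < N.+1) (n * m == i)%N%:R * ('X^(N + m) - 'X^(N - m)).
Proof.
rewrite coef_sum; apply: eq_bigr => m _.
rewrite -!rmorphXn /= -rmorphB /= coefMC -exprM coefXn eq_sym; by [].
Qed.

(** In characteristic 0 the points 1, ..., [size p] are distinct and nonzero, which is one root too
    many. *)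
Lemma poly_eq0_nonzero_points (p : {poly F}) : (forall x, x != 0 -> p.[x] = 0) -> p = 0.
Proof.
move=> h; pose rs := [seq (n.+1%:R : F) | n <- iota 0 (size p)].
apply: (@roots_geq_poly_eq0 _ p rs).
- by apply/allP => x /mapP[n _ ->]; apply/rootP/h; rewrite pnatr_eq0.
- rewrite map_inj_uniq ?iota_uniq // => m n /eqP; rewrite eqr_nat => /eqP[]; exact.
- by rewrite size_map size_iota.
Qed.

(** For nonzero x, this is [theta_prod] at z = x divided by x^L: a finite part of the two
    z-dependent products in the denominator of [C2bar]. *)
Definition theta_prod_at (x : F) L : {poly F} :=
  \prod_(i < L) ((1 - x *: 'X^(2 * i.+1)) * (1 - x^-1 *: 'X^(2 * i.+1))).

(** The bridge from statements at fixed z to Laurent polynomials in z: since [H] is the same for all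
    x, each coefficient in q gives two polynomials in z that agree at every nonzero point. *)
Lemma eqmodX_of_points N K (p : nat -> {poly F}) (H : {poly F}) :
  (forall x, x != 0 -> eqmodX N.+1
     ((\poly_(i < N.+1) (x ^- K * (p i).[x])) * theta_prod_at x N) H) ->
  eqmodX N.+1 ((\poly_(i < N.+1) p i) * theta_prod N)
    (z ^+ (K + N) * map_poly polyC H).
Proof.
move=> h k kN; apply/eqP; rewrite -subr_eq0; apply/eqP.
apply: poly_eq0_nonzero_points => x x0; rewrite -coefB.
pose ev := map_poly (horner_eval x).
have evE W : (ev W)`_k = (W`_k).[x] by rewrite coef_map.
rewrite -evE /ev rmorphB !rmorphM rmorphXn /= map_polyC /= /horner_eval hornerX.
have -> : map_poly (horner_eval x) (map_poly polyC H) = H.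
  by apply/polyP => i; rewrite !coef_map /= /horner_eval hornerC.
have -> : map_poly (horner_eval x) (\poly_(i < N.+1) p i) =
    (x ^+ K)%:P * \poly_(i < N.+1) (x ^- K * (p i).[x]).
  apply/polyP => i; rewrite coefCM coef_map !coef_poly /= /horner_eval.
  by case: ifP => _; rewrite ?horner0 ?mulr0 // mulVKf // expf_neq0.
have -> : map_poly (horner_eval x) (theta_prod N) = (x ^+ N)%:P * theta_prod_at x N.
  rewrite /theta_prod /theta_prod_at rmorph_prod /=.
  rewrite -[N in x ^+ N](card_ord N) -prodr_const rmorph_prod /= -big_split /=.
  apply: eq_bigr => i _; rewrite /theta_factor rmorphM !rmorphB rmorphM rmorph1 /=.
  rewrite map_polyXn map_polyC /= /horner_eval hornerX -!mul_polyC.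
  have e : x%:P * (x^-1)%:P = 1 :> {poly F} by rewrite -polyCM divff.
  set y := 'X^_; rewrite mulrCA; congr (_ * _).
  by rewrite mulrBr mulr1 mulrA e mul1r.
rewrite coefB -rmorphXn /= coefCM mulrACA -polyCM -exprD coefCM h //.
by rewrite subrr.
Qed.

End BivariateLogDerivative.

(* The coefficient of q^i in \sum_n sigma_j(n) q^(2n). *)
Definition sigma_double (j i : nat) : nat :=
  if (0 < i)%N && ~~ odd i then sigma j i./2 else 0.

(** For i > 0 the solutions of 2 (a + 1) m = i correspond to the divisors m of i / 2, and both
    factors stay within the ranges because i <= N. *)
Lemma sigma_doubleE (N j i : nat) : (i <= N)%N ->
  (\sum_(a < N) \sum_(1 <= m < N.+1) (2 * a.+1 * m == i) * m ^ j)%N = sigma_double j i.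
Proof.
move=> iN; rewrite /sigma_double; have [->|i0] /= := posnP i.
  rewrite big1 // => a _; rewrite big_nat big1 // => m /andP[m1 _].
  by rewrite !muln_eq0 /= -[m == 0%N]negbK -lt0n m1.
case: ifPn => oi; last first.
  rewrite negbK in oi; rewrite big1 // => a _; rewrite big1 // => m _.
  rewrite (_ : _ == _ = false) //; apply: contraTF oi => /eqP <-.
  by rewrite -mulnA oddM.
set b := i./2; have ib : i = (2 * b)%N by rewrite mul2n -[LHS]odd_double_half (negbTE oi).
have b0 : (0 < b)%N by rewrite ib muln_gt0 in i0.
have bN : (b <= N)%N by rewrite (leq_trans _ iN) // ib mul2n -addnn leq_addr.
rewrite exchange_big /= /sigma.
transitivity (\sum_(1 <= m < N.+1 | m %| b) m ^ j)%N.
  rewrite [RHS]big_mkcond /=; apply: eq_big_nat => m /andP[m0 _].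
  rewrite -big_distrl /=; case: ifPn => [/dvdnP[k bk]|mb].
    have k0 : (0 < k)%N by rewrite bk muln_gt0 in b0; case/andP: b0.
    have kN : (k.-1 < N)%N.
      by rewrite prednK // (leq_trans _ bN) // bk leq_pmulr.
    rewrite (bigD1 (Ordinal kN)) //= prednK // -mulnA -bk -ib eqxx big1 ?mul1n // => a ne.
    rewrite ib -mulnA eqn_pmul2l // bk eqn_pmul2r //.
    rewrite (_ : _ == _ = false) //; apply: contraNF ne => /eqP e.
    by apply/eqP/val_inj; rewrite /= -e.
  rewrite big1 // => a _; rewrite ib -mulnA eqn_pmul2l //.
  rewrite (_ : _ == _ = false) //; apply: contraNF mb => /eqP <-.
  exact: dvdn_mull.
rewrite -big_filter; apply: perm_big; apply: uniq_perm.
- by rewrite filter_uniq // iota_uniq.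
- exact: divisors_uniq.
- move=> d; rewrite mem_filter mem_index_iota -dvdn_divisors // andb_idr // => db.
  by rewrite (dvdn_gt0 b0 db) ltnS (leq_trans (dvdn_leq b0 db)).
Qed.

(** * From coefficients in z to moments *)

Section MomentRecurrence.
Variable F : numFieldType.
Variables (N K : nat) (M : nat -> nat -> F) (r : nat).

Let p i := \poly_(e < (2 * K).+1) M e i.
Let mom k i := \sum_(e < (2 * K).+1) M e i * (e%:R - K%:R) ^+ k.

(* [M e i] is the coefficient of z^(e - K), so that [p i] is z^K P_i(z), and
   [Phi u] is the value at z = 1 of (z d/dz)^r (z^-(K + N) u). *)
Let Phi (u : {poly F}) := \sum_(j < (2 * K + 2 * N).+1) u`_j * (j%:R - (K + N)%:R) ^+ r.

Let PhiB u v : Phi (u - v) = Phi u - Phi v.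
Proof. by rewrite -sumrB; apply: eq_bigr => j _; rewrite coefB mulrBl. Qed.

Let PhiZ a u : Phi (a *: u) = a * Phi u.
Proof. by rewrite mulr_sumr; apply: eq_bigr => j _; rewrite coefZ mulrA. Qed.

Let PhiD u v : Phi (u + v) = Phi u + Phi v.
Proof. by rewrite -big_split; apply: eq_bigr => j _; rewrite coefD mulrDl. Qed.

Let Phi_sum (I : Type) (s : seq I) (P : pred I) (u : I -> {poly F}) :
  Phi (\sum_(i <- s | P i) u i) = \sum_(i <- s | P i) Phi (u i).
Proof.
apply: (big_morph Phi PhiD); rewrite /Phi big1 // => j _; by rewrite coef0 mul0r.
Qed.

Let PhiXn n : (n <= 2 * K + 2 * N)%N -> Phi 'X^n = (n%:R - (K + N)%:R) ^+ r.
Proof.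
rewrite -ltnS => nL; rewrite /Phi (bigD1 (Ordinal nL)) //= coefXn eqxx mul1r big1 ?addr0 // => j ne.
rewrite coefXn (_ : _ == _ = false) ?mul0r //.
by apply: contraNF ne => /eqP e; apply/eqP/val_inj.
Qed.

(** With x = e - K this is the binomial expansion of (x + m)^r - (x - m)^r, the factor 1 - (-1)^j
    recording the cancellation of even powers of m. *)
Let Phi_shift m i : (m <= N)%N ->
  Phi (('X^(N + m) - 'X^(N - m)) * p i) =
  \sum_(j < r.+1) 'C(r, j)%:R * (1 - (-1) ^+ j) * mom (r - j) i * m%:R ^+ j.
Proof.
move=> mN; rewrite /p poly_def mulr_sumr Phi_sum.
transitivity (\sum_(e < (2 * K).+1) M e i *
    \sum_(j < r.+1) 'C(r, j)%:R * (1 - (-1) ^+ j) * m%:R ^+ j * (e%:R - K%:R) ^+ (r - j)).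
  apply: eq_bigr => e _; have eK : (e <= 2 * K)%N by rewrite -ltnS.
  have le1 : (N + m + e <= 2 * K + 2 * N)%N.
    by rewrite addnC leq_add // mul2n -addnn leq_add.
  have le2 : (N - m + e <= 2 * K + 2 * N)%N.
    by rewrite addnC leq_add // (leq_trans (leq_subr _ _)) // mul2n -addnn leq_addr.
  rewrite -scalerAr PhiZ; congr (_ * _); rewrite mulrBl -!exprD PhiB !PhiXn //.
  rewrite !natrD natrB //.
  have -> : N%:R + m%:R + e%:R - (K%:R + N%:R) = (e%:R - K%:R) + m%:R :> F by ring.
  have -> : N%:R - m%:R + e%:R - (K%:R + N%:R) = (e%:R - K%:R) + - m%:R :> F by ring.
  rewrite !exprDn -sumrB; apply: eq_bigr => j _.
  have alg (A : comPzRingType) (c x y s : A) : c * (x * y - x * (s * y)) = c * (1 - s) * y * x by ring.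
  by rewrite (exprNn m%:R j) -mulrnBl -[LHS]mulr_natl alg.
under eq_bigr do rewrite mulr_sumr.
rewrite exchange_big /=; apply: eq_bigr => j _; rewrite /mom mulr_sumr mulr_suml.
by apply: eq_bigr => e _; ring.
Qed.

(** [Phi] is applied to [coef_log_derivative]. On the left, z d/dz - K multiplies z^e by e - K and
    raises the order of the moment by one; on the right, [Phi_shift] produces the powers m^j, which
    sum to [sigma_double]. *)
Lemma moment_recurrence_of_points (H : {poly F}) :
  (forall x, x != 0 -> eqmodX N.+1
     ((\poly_(i < N.+1) (x ^- K * (p i).[x])) * theta_prod_at x N) H) ->
  mom r.+1 N = \sum_(i < N.+1) \sum_(j < r.+1)
    'C(r, j)%:R * (1 - (-1) ^+ j) * mom (r - j) (N - i)%N * (sigma_double j i)%:R.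
Proof.
move=> /eqmodX_of_points/coef_log_derivative/(congr1 Phi).
have -> : 'X^N * ('X * (p N)^`() - p N *+ K) =
   \sum_(e < (2 * K).+1) (M e N * (e%:R - K%:R)) *: 'X^(N + e).
  rewrite /p poly_def raddf_sum /= mulr_sumr -sumrMnl -sumrB mulr_sumr.
  apply: eq_bigr => e _; rewrite derivZ derivXn -!mul_polyC polyCM polyCB !polyC_natr exprD.
  have alg0 (A : comPzRingType) (n x m k : A) :
    n * (x * (m * 0) - m * 1 * k) = m * (0 - k) * (n * 1) by ring.
  have alg (A : comPzRingType) (n x m w l k : A) :
    n * (x * (m * (w * l)) - m * (x * w) * k) = m * (l - k) * (n * (x * w)) by ring.
  (* Exponent 0 is treated apart: X times X^(e-1) is X^e only for e > 0, the predecessor of 0 being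
     0. *)
  case: (nat_of_ord e) => [|k]; rewrite -[_ *+ K]mulr_natr ?mulr0n ?expr0 ?alg0 //.
  by rewrite exprS -['X^_ *+ k.+1]mulr_natr alg.
rewrite Phi_sum => e; rewrite (_ : mom r.+1 N = \sum_(e < (2 * K).+1) Phi ((M e N * (e%:R - K%:R)) *: 'X^(N + e))).
  rewrite e Phi_sum; apply: eq_bigr => i _; rewrite coef_sum mulr_suml Phi_sum.
  transitivity (\sum_(a < N) \sum_(1 <= m < N.+1) (2 * a.+1 * m == i)%N%:R *
     \sum_(j < r.+1) 'C(r, j)%:R * (1 - (-1) ^+ j) * mom (r - j) (N - i) * m%:R ^+ j).
    apply: eq_bigr => a _; rewrite coef_lambert_sum mulr_suml Phi_sum.
    apply: eq_big_nat => m /andP[_ mN]; rewrite -Phi_shift // -PhiZ; congr Phi.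
    by rewrite -mul_polyC polyC_natr mulrA.
  under eq_bigr do (under eq_bigr do rewrite mulr_sumr); under eq_bigr do rewrite exchange_big.
  rewrite exchange_big /=; apply: eq_bigr => j _.
  rewrite -(@sigma_doubleE N); last by rewrite -ltnS.
  rewrite natr_sum [RHS]mulr_sumr; apply: eq_bigr => a _.
  rewrite natr_sum [RHS]mulr_sumr; apply: eq_bigr => m _.
  by rewrite natrM natrX; ring.
apply: eq_bigr => j _; rewrite PhiZ PhiXn; last first.
  have jK : (j <= 2 * K)%N by rewrite -ltnS.
  by rewrite addnC leq_add // mul2n -addnn leq_addr.
rewrite !natrD exprS -mulrA; congr (_ * (_ * _ ^+ _)); by ring.
Qed.

End MomentRecurrence.

(** * Expansion at q = 0 *)

Section Jets.
Variable R : realType.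
Implicit Types (f g : R[i] -> R[i]) (p q : {poly R[i]}).

Lemma normc_horner_le p (x : R[i]) : normc x <= 1 ->
  normc p.[x] <= \sum_(i < size p) normc p`_i.
Proof.
move=> x1; rewrite horner_coef; apply: le_trans (normc_sum _ _ _) _.
apply: ler_sum => i _; rewrite normcM normcX ler_piMr ?normc_ge0 //.
by rewrite exprn_ile1 // normc_ge0.
Qed.

Lemma normc_real (x : R) : normc (x%:C%C) = `|x|.
Proof. by rewrite /= expr0n addr0 sqrtr_sqr. Qed.

(** Writing p = p_0 + X d, the constant term p(t) - t d(t) tends to 0 with t; once p_0 = 0, d
    satisfies the same bound with exponent one less. *)
Lemma coef_small_poly N (c K : R) p : 0 < c ->
  (forall x, 0 < normc x < c -> normc p.[x] <= K * normc x ^+ N) ->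
  forall k, (k < N)%N -> p`_k = 0.
Proof.
move=> c0; elim: N p => // N IH p hp.
pose d := drop_poly 1 p.
have pE : p = (p`_0)%:P + d * 'X.
  rewrite -{1}(poly_take_drop 1 p) expr1; congr (_ + _).
  by apply/polyP => i; rewrite coef_take_poly coefC; case: i.
set B := \sum_(i < size d) normc d`_i.
have B0 : 0 <= B by rewrite sumr_ge0 // => i _; exact: normc_ge0.
have K0 : 0 <= K.
  have h2 : 0 < normc ((c / 2)%:C%C) < c by rewrite normc_real gtr0_norm; lra.
  have := hp _ h2; rewrite -(pmulr_lge0 K (x := normc (c / 2)%:C%C ^+ N.+1)).
    by apply: le_trans; exact: normc_ge0.
  by rewrite exprn_gt0 //; case/andP: h2.
have p0 : p`_0 = 0.
  apply/eqP; rewrite -normc_eq0 eq_le normc_ge0 andbT.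
  apply/ler_addgt0Pr => e e0; rewrite add0r.
  (* Besides lying in the admissible disc, t is small enough that |p(t)| + t |d(t)| <= (K + B) t <=
     e. *)
  pose t := Num.min (c / 2) (Num.min 1 (e / (K + B + 1))).
  have KB : 0 < K + B + 1 by lra.
  have t0 : 0 < t by rewrite /t !lt_min ltr01 divr_gt0 // ?divr_gt0.
  have t1 : t <= 1 by rewrite /t !ge_min lexx orbT.
  have tc : t < c by rewrite /t gt_min; apply/orP; left; lra.
  have te : t * (K + B + 1) <= e by rewrite -ler_pdivlMr // /t !ge_min lexx !orbT.
  have nt : normc (t%:C%C) = t by rewrite normc_real gtr0_norm.
  have := hp t%:C%C; rewrite nt t0 tc => /(_ isT) ht.
  have -> : p`_0 = p.[t%:C%C] - d.[t%:C%C] * t%:C%C.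
    by rewrite {2}pE !hornerE addrK.
  apply: le_trans (le_normcD _ _) _; rewrite normcN normcM nt.
  have d1 : normc d.[t%:C%C] <= B by apply: normc_horner_le; rewrite nt.
  have : K * t ^+ N.+1 <= K * t.
    by rewrite ler_wpM2l // exprS ler_piMr ?(ltW t0) // exprn_ile1 // ltW.
  have : normc d.[t%:C%C] * t <= B * t by rewrite ler_wpM2r // ltW.
  by move: ht te t0; lra.
have hd k : (k < N)%N -> d`_k = 0.
  apply: IH => x /andP[x0 xc]; have := hp x; rewrite x0 xc => /(_ isT).
  by rewrite pE p0 add0r hornerMX normcM exprSr mulrA ler_pM2r.
case=> [//|k]; rewrite ltnS => /hd.
by rewrite coef_drop_poly addn1.
Qed.

(** A Taylor expansion at 0 with no appeal to differentiability, yet strong enough to determine the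
    coefficients below order [N]. *)
Definition jet N f p := exists c K : R, 0 < c /\
  forall x, 0 < normc x < c -> normc (f x - p.[x]) <= K * normc x ^+ N.

Lemma jet_unique N f p q : jet N f p -> jet N f q -> eqmodX N p q.
Proof.
move=> [c [K [c0 hp]]] [c' [K' [c0' hq]]] k kN.
apply/eqP; rewrite -subr_eq0 -coefB; apply/eqP.
apply: (@coef_small_poly N (Num.min c c') (K + K')) => //; first by rewrite lt_min c0.
move=> x; rewrite lt_min => /and3P[x0 xc xc'].
rewrite hornerD hornerN mulrDl.
have -> : p.[x] - q.[x] = - (f x - p.[x]) + (f x - q.[x]) by ring.
apply: le_trans (le_normcD _ _) _; rewrite normcN lerD //.
  by apply: hp; rewrite x0.
by apply: hq; rewrite x0.
Qed.

Lemma jetM N f g p q : jet N f p -> jet N g q -> jet N (fun x => f x * g x) (p * q).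
Proof.
move=> [c [K [c0 hp]]] [c' [K' [c0' hq]]].
pose B := \sum_(i < size p) normc p`_i.
pose B' := \sum_(i < size q) normc q`_i.
have nng (r : {poly R[i]}) : 0 <= \sum_(i < size r) normc r`_i.
  by rewrite sumr_ge0 // => i _; exact: normc_ge0.
exists (Num.min c (Num.min c' 1)), (`|K| * (B' + `|K'|) + B * `|K'|); split.
  by rewrite !lt_min c0 c0' ltr01.
move=> x; rewrite !lt_min => /and4P[x0 xc xc' x1].
have hpx : normc (f x - p.[x]) <= `|K| * normc x ^+ N.
  apply: le_trans (hp x _) _; first by rewrite x0.
  by rewrite ler_wpM2r ?ler_norm // exprn_ge0 // ltW.
have hqx : normc (g x - q.[x]) <= `|K'| * normc x ^+ N.
  apply: le_trans (hq x _) _; first by rewrite x0.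
  by rewrite ler_wpM2r ?ler_norm // exprn_ge0 // ltW.
have xN : normc x ^+ N <= 1 by rewrite exprn_ile1 // ltW.
have hg : normc (g x) <= B' + `|K'|.
  have -> : g x = q.[x] + (g x - q.[x]) by ring.
  apply: le_trans (le_normcD _ _) _; rewrite lerD //; first by rewrite normc_horner_le // ltW.
  by apply: le_trans hqx _; rewrite ler_piMr.
rewrite hornerM.
have -> : f x * g x - p.[x] * q.[x] = (f x - p.[x]) * g x + p.[x] * (g x - q.[x]) by ring.
apply: le_trans (le_normcD _ _) _; rewrite !normcM mulrDl lerD //.
  rewrite mulrAC; apply: ler_pM => //; exact: normc_ge0.
rewrite -mulrA; apply: ler_pM => //; try exact: normc_ge0.
by rewrite normc_horner_le // ltW.
Qed.

Lemma jet_near N (c : R) f g p : 0 < c -> (forall x, normc x < c -> f x = g x) ->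
  jet N f p -> jet N g p.
Proof.
move=> c0 fg [c' [K [c0' hp]]]; exists (Num.min c c'), K; split; first by rewrite lt_min c0.
by move=> x; rewrite lt_min => /and3P[x0 xc xc']; rewrite -fg // hp // x0.
Qed.

(** The error left by the first [N] factors is O(x^(2N+2)), better than required. *)
Lemma jet_qpochhammer N (a : R[i]) :
  jet N.+1 (fun x => qpochhammer (a * x ^+ 2) (x ^+ 2))
    (\prod_(i < N) (1 - a *: 'X^(2 * i.+1))).
Proof.
(* For |x| < 1/2 both |x|^2 / (1 - |x|^2) <= 1, which bounds the exponential, and 1 / (1 - |x|^2) <=
   2. *)
exists (2^-1), (expR (normc a) * normc a * 2); split; first by lra.
move=> x /andP[x0 xc].
have x2 : normc (x ^+ 2) = normc x ^+ 2 by rewrite normcX.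
have x21 : normc x ^+ 2 <= 2^-1.
  rewrite expr2; have : normc x * normc x <= normc x * 2^-1 by rewrite ler_wpM2l ?ltW.
  by lra.
have -> : (\prod_(i < N) (1 - a *: 'X^(2 * i.+1))).[x] =
    \prod_(0 <= n < N) (1 - a * x ^+ 2 * (x ^+ 2) ^+ n).
  rewrite big_mkord horner_prod; apply: eq_bigr => i _.
  by rewrite hornerD hornerN hornerC hornerZ hornerXn exprM exprS mulrA.
apply: le_trans (qpochhammer_dist_le _ _ _) _; first by rewrite x2; lra.
rewrite normcM x2 ler_pdivrMr; last by lra.
have h1 : expR (normc a * normc x ^+ 2 / (1 - normc x ^+ 2)) <= expR (normc a).
  rewrite ler_expR -mulrA ler_piMr ?normc_ge0 // ler_pdivrMr; last by lra.
  by lra.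
have h2 : normc x ^+ 2 * (normc x ^+ 2) ^+ N <= normc x ^+ N.+1.
  rewrite -exprS -exprM mul2n -addnn exprD ler_piMr ?exprn_ge0 ?(ltW x0) //.
  by rewrite exprn_ile1 ?(ltW x0) //; lra.
have h3 : 1 <= 2 * (1 - normc x ^+ 2) by lra.
set u := expR (_ / _) in h1 *; have u0 : 0 <= u by exact: expR_ge0.
apply: (@le_trans _ _ (expR (normc a) * (normc a * normc x ^+ N.+1))).
  rewrite -(mulrA u) -(mulrA (normc a)); apply: ler_pM => //.
    by rewrite !mulr_ge0 ?normc_ge0 // !exprn_ge0 // ltW.
  by rewrite ler_wpM2l ?normc_ge0.
have -> : expR (normc a) * normc a * 2 * normc x ^+ N.+1 * (1 - normc x ^+ 2) =
  expR (normc a) * (normc a * normc x ^+ N.+1) * (2 * (1 - normc x ^+ 2)) by ring.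
by rewrite ler_peMr // !mulr_ge0 ?expR_ge0 ?normc_ge0 // exprn_ge0 // ltW.
Qed.

Lemma cvgc_series_terms_bounded (u : nat -> R[i]) l : cvgc (series u) l ->
  exists B : R, forall n, normc (u n) <= B.
Proof.
move=> /cvgc_bounded[B B0 hB]; exists (B + B) => n.
have -> : u n = series u n.+1 - series u n.
  by rewrite seriesSB.
by apply: le_trans (le_normcD _ _) _; rewrite normcN lerD.
Qed.

(** Convergence at the single point t = c / 2 bounds all |u_n| t^n by some B. For |x| < t / 2 the
    series is then dominated by a geometric one of ratio r = |x| / t <= 1/2, whose tail is at most 2
    B r^N. *)
Lemma jet_series N (c : R) (u : nat -> R[i]) f : 0 < c ->
  (forall x, normc x < c -> cvgc (series (fun n => u n * x ^+ n)) (f x)) ->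
  jet N f (\poly_(i < N) u i).
Proof.
move=> c0 h; pose t := c / 2; have t0 : 0 < t by rewrite /t; lra.
have nt : normc (t%:C%C) = t by rewrite normc_real gtr0_norm.
have [|B hB] := @cvgc_series_terms_bounded (fun n => u n * t%:C%C ^+ n) (f t%:C%C).
  by apply: h; rewrite nt /t; lra.
have {}hB n : normc (u n) * t ^+ n <= B by rewrite -{1}nt -normcX -normcM.
exists (t / 2), (B * 2 / t ^+ N); split; first by lra.
move=> x /andP[x0 xc]; set r := normc x / t.
have r0 : 0 <= r by rewrite divr_ge0 // ltW.
have r1 : r <= 2^-1 by rewrite ler_pdivrMr //; lra.
have hr : 0 <= r < 1 by rewrite r0 /=; lra.
have B0 : 0 <= B by apply: le_trans (hB 0%N); rewrite expr0 mulr1 normc_ge0.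
have hstep n : normc (series (fun n => u n * x ^+ n) n.+1 - series (fun n => u n * x ^+ n) n)
    <= B * r ^+ n.
  rewrite seriesSB normcM normcX.
  have -> : normc x ^+ n = t ^+ n * r ^+ n by rewrite -exprMn mulrC divfK // gt_eqF.
  by rewrite mulrA ler_wpM2r // exprn_ge0.
have hx : normc x < c by move: xc; rewrite /t; lra.
have := geometric_lim_dist_le N hr (h x hx) hstep.
have -> : series (fun n => u n * x ^+ n) N = (\poly_(i < N) u i).[x].
  by rewrite horner_poly /series /= big_mkord.
move=> hN; apply: le_trans hN _.
have -> : B * 2 / t ^+ N * normc x ^+ N = B * r ^+ N * 2.
  have -> : r ^+ N = normc x ^+ N / t ^+ N by exact: expr_div_n.
  by rewrite -!mulrA; congr (_ * _); rewrite mulrA mulrC [2 * _]mulrC.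
rewrite ler_pdivrMr; last by lra.
by rewrite -[leRHS]mulrA ler_peMr ?mulr_ge0 ?exprn_ge0 //; lra.
Qed.

End Jets.

(** * Cauchy products *)

Section Subexponential.
Variable R : realType.
Implicit Types (a b : nat -> R[i]).

(** Equivalent to a radius of convergence at least 1, in a form that passes easily to sums, products
    and convolutions. *)
Definition subexponential a :=
  forall t : R, 1 < t -> exists B : R, forall n, normc (a n) <= B * t ^+ n.

Definition convolution a b n := \sum_(i < n.+1) a (n - i)%N * b i.

Definition power_series a (q : R[i]) := series (fun n => a n * q ^+ n).

Lemma subexponential_bound a (t : R) : subexponential a -> 1 < t ->
  exists2 B : R, 0 <= B & forall n, normc (a n) <= B * t ^+ n.
Proof.
move=> h /h[B hB]; exists B => //.
by have := hB 0%N; rewrite expr0 mulr1; apply: le_trans; exact: normc_ge0.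
Qed.

Lemma sqrt_gt1 (t : R) : 1 < t -> 1 < Num.sqrt t.
Proof. by move=> t1; rewrite -sqrtr1 ltr_sqrt // (lt_trans ltr01). Qed.

(** The constant equals t / (t - 1); times t - 1 it is t >= 1, so the right side grows by at least 1
    at each step. *)
Lemma natS_le_exp (t : R) n : 1 < t -> n.+1%:R <= (1 + (t - 1)^-1) * t ^+ n.
Proof.
move=> t1; have d0 : 0 < t - 1 by rewrite subr_gt0.
have di : (t - 1)^-1 * (t - 1) = 1 by rewrite mulVf // gt_eqF.
have i0 : 0 < (t - 1)^-1 by rewrite invr_gt0.
elim: n => [|n IH]; first by rewrite expr0 mulr1 lerDl ltW.
rewrite -natr1 exprSr mulrA; apply: (@le_trans _ _ (n.+1%:R + (1 + (t - 1)^-1) * t ^+ n * (t - 1))).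
  rewrite lerD2l; have tn : 1 <= t ^+ n by rewrite exprn_ege1 // ltW.
  rewrite -mulrA [t ^+ n * _]mulrC mulrA mulrDl mul1r di.
  have : (t - 1 + 1) * 1 <= (t - 1 + 1) * t ^+ n by rewrite ler_wpM2l //; lra.
  by apply: le_trans; lra.
set u := (1 + _) * t ^+ n in IH *.
have -> : u * t = u + u * (t - 1) by ring.
by rewrite lerD2r.
Qed.

Lemma subexponentialM a b : subexponential a -> subexponential b ->
  subexponential (fun n => a n * b n).
Proof.
move=> ha hb t t1; have t0 : 0 <= t by rewrite ltW // (lt_trans ltr01).
have [B B0 hB] := subexponential_bound ha (sqrt_gt1 t1).
have [B' _ hB'] := subexponential_bound hb (sqrt_gt1 t1).
exists (B * B') => n.
have -> : B * B' * t ^+ n = (B * Num.sqrt t ^+ n) * (B' * Num.sqrt t ^+ n).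
  by rewrite mulrACA -exprMn -expr2 sqr_sqrtr.
by rewrite normcM ler_pM // normc_ge0.
Qed.

Lemma subexponentialD a b : subexponential a -> subexponential b ->
  subexponential (fun n => a n + b n).
Proof.
move=> ha hb t t1; have [B hB] := ha _ t1; have [B' hB'] := hb _ t1.
exists (B + B') => n; rewrite mulrDl; apply: le_trans (le_normcD _ _) _; exact: lerD.
Qed.

Lemma subexponential_cst c : subexponential (fun=> c).
Proof.
by move=> t t1; exists (normc c) => n; rewrite ler_peMr ?normc_ge0 // exprn_ege1 // ltW.
Qed.

Lemma subexponential_sum (I : Type) (r : seq I) (U : I -> nat -> R[i]) :
  (forall i, subexponential (U i)) -> subexponential (fun n => \sum_(i <- r) U i n).
Proof.
move=> h; elim: r => [|i r IH] t t1.
  have [B hB] := subexponential_cst 0 t1; exists B => n; by rewrite big_nil.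
have [B hB] := subexponentialD (h i) IH t1; exists B => n; by rewrite big_cons.
Qed.

Lemma subexponential_natS : subexponential (fun n => n.+1%:R).
Proof.
by move=> t t1; exists (1 + (t - 1)^-1) => n; rewrite normc_natr natS_le_exp.
Qed.

Lemma subexponential_le a b : (forall n, normc (a n) <= normc (b n)) ->
  subexponential b -> subexponential a.
Proof.
move=> h hb t t1; have [B hB] := hb _ t1; exists B => n; exact: le_trans (h n) (hB n).
Qed.

Lemma subexponential_exp a k : subexponential a -> subexponential (fun n => a n ^+ k).
Proof.
move=> h; elim: k => [|k IH]; first exact: (subexponential_cst 1).
apply: subexponential_le (subexponentialM h IH) => n; by rewrite exprS.
Qed.

(** Each of the n + 1 terms is at most B B' t^n, and their number costs one further factor t^n.
    Applied at a square root of the target rate, the bound keeps subexponential growth. *)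
Lemma convolution_bound a b (B B' t : R) n : 1 < t -> 0 <= B -> 0 <= B' ->
  (forall n, normc (a n) <= B * t ^+ n) -> (forall n, normc (b n) <= B' * t ^+ n) ->
  normc (convolution a b n) <= (1 + (t - 1)^-1) * (B * B') * (t * t) ^+ n.
Proof.
move=> t1 B0 B'0 ha hb; have t0 : 0 <= t by lra.
apply: (@le_trans _ _ (n.+1%:R * (B * B' * t ^+ n))).
  apply: le_trans (normc_sum _ _ _) _.
  rewrite -[n.+1 in leRHS]card_ord -sumr_const mulr_suml; apply: ler_sum => i _.
  have -> : t ^+ n = t ^+ (n - i) * t ^+ i by rewrite -exprD subnK // -ltnS.
  by rewrite mul1r mulrACA normcM; apply: ler_pM; rewrite ?normc_ge0.
rewrite exprMn mulrA [_ * (B * B')]mulrC [(1 + _) * _]mulrC -!mulrA.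
do 2![apply: ler_wpM2l => //]; rewrite !mulrA ler_wpM2r ?exprn_ge0 //.
exact: natS_le_exp.
Qed.

Lemma subexponential_convolution a b : subexponential a -> subexponential b ->
  subexponential (convolution a b).
Proof.
move=> ha hb t t1; have s1 := sqrt_gt1 t1.
have [B B0 hB] := subexponential_bound ha s1.
have [B' B'0 hB'] := subexponential_bound hb s1.
exists ((1 + (Num.sqrt t - 1)^-1) * (B * B')) => n.
have tt : Num.sqrt t * Num.sqrt t = t by rewrite -expr2 sqr_sqrtr // ltW // (lt_trans ltr01).
by rewrite -{2}tt; exact: convolution_bound.
Qed.

Lemma ratio_between (r : R) : 0 <= r < 1 -> exists2 t : R, 1 < t & 0 <= t * r < 1.
Proof.
move=> /andP[r0 r1]; exists (2 / (1 + r)); first by rewrite ltr_pdivlMr; lra.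
have r2 : 0 < 1 + r by lra.
rewrite mulr_ge0 ?divr_ge0 //=; try lra.
by rewrite mulrAC ltr_pdivrMr //; lra.
Qed.

Lemma subexponential_terms a (q : R[i]) : subexponential a -> normc q < 1 ->
  exists B r : R, [/\ 0 <= B, 0 <= r < 1 & forall n, normc (a n * q ^+ n) <= B * r ^+ n].
Proof.
move=> ha q1; have [|t t1 tq] := @ratio_between (normc q); first by rewrite normc_ge0.
have [B B0 hB] := subexponential_bound ha t1.
exists B, (t * normc q); split=> // n.
by rewrite normcM normcX exprMn mulrA ler_wpM2r // exprn_ge0 // normc_ge0.
Qed.

Lemma cvgc_power_series a (q : R[i]) : subexponential a -> normc q < 1 ->
  exists l, cvgc (power_series a q) l.
Proof.
move=> ha q1; have [B [r [B0 hr hB]]] := subexponential_terms ha q1.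
by apply: (cvgc_geometric (K := B) hr) => n; rewrite seriesSB.
Qed.

(** The product of the N-th partial sums and the N-th partial sum of the convolution agree in
    degrees below N; the rest lies in degrees N to 2N - 1 and is dominated by a geometric tail. *)
Lemma cvgc_power_series_convolution a b (q la lb : R[i]) :
  subexponential a -> subexponential b -> normc q < 1 ->
  cvgc (power_series a q) la -> cvgc (power_series b q) lb ->
  cvgc (power_series (convolution a b) q) (la * lb).
Proof.
move=> ha hb q1 hla hlb.
have [|t t1 tq] := @ratio_between (normc q); first by rewrite normc_ge0.
have s1 := sqrt_gt1 t1; have s0 := sqrtr_ge0 t.
have [B B0 hB] := subexponential_bound ha s1.
have [B' B'0 hB'] := subexponential_bound hb s1.
have tt : Num.sqrt t * Num.sqrt t = t by rewrite -expr2 sqr_sqrtr //; lra.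
set r := t * normc q in tq; set D := (1 + (Num.sqrt t - 1)^-1) * (B * B').
have D0 : 0 <= D.
  by rewrite !mulr_ge0 // addr_ge0 // invr_ge0; lra.
have prod_dist N : normc (power_series (convolution a b) q N
    - power_series a q N * power_series b q N) <= D * r ^+ N / (1 - r).
  (* With both sequences cut at N, the product of the partial sums is exactly a sum with
     coefficients [convolution aN bN], which obeys the same bounds. *)
  pose aN i := if (i < N)%N then a i else 0; pose bN i := if (i < N)%N then b i else 0.
  have trunc (c : nat -> R[i]) (E : R) : 0 <= E ->
      (forall n, normc (c n) <= E * Num.sqrt t ^+ n) ->
      forall n, normc (if (n < N)%N then c n else 0) <= E * Num.sqrt t ^+ n.
    by move=> E0 hc n; case: ifP => // _; rewrite normc0 mulr_ge0 // exprn_ge0.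
  have hcv n : normc (convolution aN bN n * q ^+ n) <= D * r ^+ n.
    rewrite normcM normcX /r exprMn mulrA ler_wpM2r ?exprn_ge0 ?normc_ge0 //.
    rewrite -[t]tt; apply: convolution_bound => //; exact: trunc.
  have -> : power_series a q N * power_series b q N =
      \sum_(0 <= n < N + N) convolution aN bN n * q ^+ n.
    have polyE (c : nat -> R[i]) : power_series c q N = (\poly_(i < N) c i).[q].
      by rewrite horner_poly /power_series /series /= big_mkord.
    rewrite !polyE -hornerM (@horner_coef_wide _ (N + N)).
      rewrite big_mkord; apply: eq_bigr => n _; congr (_ * _).
      rewrite coefMr; apply: eq_bigr => i _; by rewrite !coef_poly.
    apply: leq_trans (size_polyMleq _ _) _.
    by rewrite (leq_trans (leq_pred _)) // leq_add // size_poly.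
  have -> : power_series (convolution a b) q N = \sum_(0 <= n < N) convolution aN bN n * q ^+ n.
    rewrite /power_series /series /= !big_mkord; apply: eq_bigr => n _; congr (_ * _).
    apply: eq_bigr => i _; rewrite /aN /bN (leq_ltn_trans (leq_subr _ _) (ltn_ord n)).
    by rewrite (leq_trans (ltn_ord i) (ltn_ord n)).
  rewrite [X in _ - X](@big_cat_nat _ _ _ N) //= ?leq_addr // opprD addrA subrr sub0r normcN.
  apply: le_trans (normc_sum _ _ _) _.
  apply: (@le_trans _ _ (\sum_(N <= i < N + N) D * r ^+ i)).
    by apply: ler_sum => i _.
  rewrite -mulr_sumr -mulrA ler_wpM2l //; exact: sum_geometric_le.
have h0 : cvgc (fun N => power_series (convolution a b) q N
    - power_series a q N * power_series b q N) 0.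
  apply: (@cvgc_dominated _ _ _ (fun N => (D / (1 - r)) * r ^+ N)).
    by near=> N; rewrite subr0 mulrAC; exact: prod_dist.
  exact: geometric_cvg0.
rewrite -[la * lb]add0r; apply: cvgc_eq (cvgcD h0 (cvgcM hla hlb)) => N.
by rewrite subrK.
Unshelve. all: by end_near. Qed.

End Subexponential.

(** * Crank moments *)

Lemma finite_set_int_bounded (S : set int) : finite_set S ->
  exists K : nat, forall m, S m -> (`|m| <= K)%N.
Proof.
move=> /finite_seqP[s ->]; exists (\max_(m <- s) `|m|%N) => m /= ms.
exact: leq_bigmax_seq.
Qed.

(** The bound makes the support finite, which excludes the default value 0, and e = m + K turns the
    sum into an ordinary one. *)
Lemma fsbig_int_interval (V : nmodType) (G : int -> V) (K : nat) :
  (forall m, G m != 0 -> (`|m| <= K)%N) ->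
  \sum_(m \in [set: int]) G m = \sum_(e < (2 * K).+1) G (e%:Z - K%:Z).
Proof.
move=> hG; pose r := [seq (e%:Z - K%:Z) | e <- iota 0 (2 * K).+1].
transitivity (\sum_(m \in [set` r]) G m); last first.
  rewrite -fsbig_seq; last first.
    by rewrite map_inj_uniq ?iota_uniq // => x y /addIr[].
  by rewrite big_map (_ : iota 0 _ = index_iota 0 (2 * K).+1) ?big_mkord // /index_iota subn0.
apply/esym; apply: fsbig_widen => // m /= [_ mr].
apply/eqP; apply: contra_notT mr => /hG mK.
have m0 : 0 <= (m : int) + Posz K by lia.
apply/mapP; exists (absz ((m : int) + Posz K)); last by rewrite gez0_abs // addrK.
by rewrite mem_iota add0n /=; lia.
Qed.

Section CrankMoments.
Variables (R : realType) (M2 : int -> nat -> int).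
Hypothesis hM2 : second_residual_crank_coef R[i] M2.

Definition moment_coef (r n : nat) : R[i] := (crank_moment M2 r n)%:~R.

Definition crank_poly_at (z : R[i]) (n : nat) : R[i] :=
  \sum_(m \in [set: int]) (M2 m n)%:~R * z ^ m.

(** One bound for all n <= N, so that a single power z^K makes every P_n in the truncation a
    polynomial. *)
Lemma crank_support_bound N :
  exists K : nat, forall n, (n <= N)%N -> forall m, M2 m n != 0 -> (`|m| <= K)%N.
Proof.
elim: N => [|N [K hK]].
  have [K hK] := finite_set_int_bounded (hM2.1 0%N).
  by exists K => n; rewrite leqn0 => /eqP -> m; exact: hK.
have [K' hK'] := finite_set_int_bounded (hM2.1 N.+1).
exists (maxn K K') => n; rewrite leq_eqVlt => /orP[/eqP -> m h|].
  by rewrite leq_max (hK' m h) orbT.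
by rewrite ltnS => nN m h; rewrite leq_max (hK n nN m h).
Qed.

Lemma cvgc_crank_series (z q : R[i]) : z != 0 -> normc q < 1 ->
  normc q ^+ 2 < normc z -> normc z * normc q ^+ 2 < 1 ->
  cvgc (series (fun n => crank_poly_at z n * q ^+ n)) (C2bar z q).
Proof.
move=> z0 q1 qz zq; apply/cvg_numP; apply: hM2.2 => //.
- by rewrite normr_normc ltcR.
- by rewrite !normr_normc -rmorphXn ltcR.
- by rewrite !normr_normc -rmorphXn -rmorphM ltcR.
Qed.

Lemma qpochhammer_small_neq0 (a q : R[i]) : normc q < 1 -> normc a < 1 ->
  qpochhammer a q != 0.
Proof.
move=> q1 a1; apply: qpochhammer_neq0 => // n; apply/eqP => /eqP.
rewrite subr_eq0 => /eqP/(congr1 (@normc R)).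
rewrite normc1 normcM normcX => h; have : normc a * normc q ^+ n < 1.
  apply: le_lt_trans a1; rewrite ler_piMr ?normc_ge0 // exprn_ile1 ?normc_ge0 //.
  exact: ltW.
by rewrite -h ltxx.
Qed.

Definition crank_free_part (q : R[i]) :=
  qpochhammer (- q) q * qpochhammer (q ^+ 2) (q ^+ 2) / qpochhammer q (q ^+ 2).

Definition crank_denominator (z q : R[i]) :=
  qpochhammer (z * q ^+ 2) (q ^+ 2) * qpochhammer (q ^+ 2 / z) (q ^+ 2).

Lemma C2barE (z q : R[i]) : C2bar z q = crank_free_part q / crank_denominator z q.
Proof.
by rewrite /C2bar /crank_free_part /crank_denominator -(mulrA (qpochhammer q (q ^+ 2))) invfM !mulrA.
Qed.

Lemma C2bar1_neq0 (q : R[i]) : normc q < 1 -> C2bar 1 q != 0.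
Proof.
move=> q1; have q2 : normc (q ^+ 2) < 1 by rewrite normcX expr_lt1 ?normc_ge0.
rewrite /C2bar mul1r divr1 !mulf_neq0 ?invr_neq0 ?mulf_neq0 //;
  by rewrite qpochhammer_small_neq0 ?normcN.
Qed.

(* The jet is the same for all z, whence the coefficients of the polynomial on
   the right do not depend on z either. *)
Lemma jet_crank_free_part N (z : R[i]) : z != 0 ->
  jet N.+1 crank_free_part
    ((\poly_(i < N.+1) crank_poly_at z i) * theta_prod_at z N).
Proof.
move=> z0; have nz : 0 < normc z by rewrite normc_gt0.
(* As |q|^2 <= |q| for |q| < 1, these bounds put z in the annulus where the series converges and the
   denominator has no zero. *)
pose c := Num.min 2^-1 (Num.min (normc z) (normc z)^-1).
have c0 : 0 < c by rewrite /c lt_min lt_min invr_gt0 ltr0n invr_gt0 nz.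
have small q : normc q < c -> [/\ normc q < 1, normc q ^+ 2 < normc z & normc z * normc q ^+ 2 < 1].
  rewrite !lt_min => /and3P[q2 qz qzi]; have q0 := normc_ge0 q.
  have qq : normc q ^+ 2 <= normc q.
    by rewrite expr2 ler_piMr //; lra.
  split; [lra|exact: le_lt_trans qz|].
  by rewrite mulrC -ltr_pdivlMr // div1r (le_lt_trans qq).
apply: (jet_near (c := c) (f := fun q => C2bar z q * crank_denominator z q)) => //.
  move=> q /small[q1 qz zq]; rewrite C2barE divfK //.
  have q2 : normc (q ^+ 2) < 1 by rewrite normcX expr_lt1 ?normc_ge0.
  rewrite mulf_neq0 ?qpochhammer_small_neq0 //; rewrite normcM normcX //.
  by rewrite normcV ltr_pdivrMr // mul1r.
apply: jetM.
  apply: (@jet_series _ N.+1 c (crank_poly_at z) (C2bar z) c0) => q /small[q1 qz zq].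
  exact: cvgc_crank_series.
rewrite /theta_prod_at big_split /=; apply: jetM; first exact: jet_qpochhammer.
have e : (fun q : R[i] => qpochhammer (q ^+ 2 / z) (q ^+ 2)) =1
         (fun q => qpochhammer (z^-1 * q ^+ 2) (q ^+ 2)).
  by move=> q; rewrite mulrC.
apply: (jet_near c0 (f := fun q => qpochhammer (z^-1 * q ^+ 2) (q ^+ 2))) => //.
exact: jet_qpochhammer.
Qed.

Lemma moment_coef_rec (r N : nat) :
  moment_coef r.+1 N = \sum_(i < N.+1) \sum_(j < r.+1)
    'C(r, j)%:R * (1 - (-1) ^+ j) * moment_coef (r - j) (N - i)%N * (sigma_double j i)%:R.
Proof.
have [K hK] := crank_support_bound N.
pose M (e i : nat) : R[i] := (M2 (e%:Z - K%:Z) i)%:~R.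
have momE k i : (i <= N)%N ->
    moment_coef k i = \sum_(e < (2 * K).+1) M e i * (e%:R - K%:R) ^+ k.
  move=> iN; rewrite /moment_coef /crank_moment (@fsbig_int_interval _ _ K).
    rewrite rmorph_sum; apply: eq_bigr => e _.
    by rewrite rmorphM rmorphXn rmorphB /= mulrC.
  move=> m h; apply: (hK i iN); apply: contraNneq h => ->; by rewrite mulr0.
(* H is taken at z = 1; [jet_unique] identifies it with its analogue at any nonzero z, both being
   jets of [crank_free_part]. *)
rewrite momE // (@moment_recurrence_of_points _ N K M r
    ((\poly_(i < N.+1) crank_poly_at 1 i) * theta_prod_at 1 N)).
  apply: eq_bigr => i _; apply: eq_bigr => j _; by rewrite momE // leq_subr.
move=> z z0.
have -> : \poly_(i < N.+1) (z ^- K * (\poly_(e < (2 * K).+1) M e i).[z]) =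
    \poly_(i < N.+1) crank_poly_at z i.
  apply/polyP => i; rewrite !coef_poly; case: ifP => // iN.
  rewrite /crank_poly_at (@fsbig_int_interval _ _ K).
    rewrite horner_poly mulr_sumr; apply: eq_bigr => e _.
    by rewrite expfzDr // -exprnN -exprnP mulrCA [z ^- K * _]mulrC.
  move=> m h; apply: (hK i iN); apply: contraNneq h => ->; by rewrite mul0r.
apply: (@jet_unique _ _ crank_free_part); apply: jet_crank_free_part => //.
Qed.

Lemma cvgc_moment0 (q : R[i]) : normc q < 1 -> cvgc (power_series (moment_coef 0) q) (C2bar 1 q).
Proof.
move=> q1; apply: (@cvgc_eq _ (series (fun n => crank_poly_at 1 n * q ^+ n))).
  move=> n; apply: eq_bigr => i _; congr (_ * _).
  rewrite /crank_poly_at /moment_coef /crank_moment.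
  have [K hK] := crank_support_bound i.
  rewrite !(@fsbig_int_interval _ _ K).
  - by rewrite rmorph_sum; apply: eq_bigr => e _; rewrite exp1rz mulr1 expr0 mul1r.
  - by move=> m h; apply: (hK i) => //; apply: contraNneq h => ->; rewrite mulr0.
  - by move=> m h; apply: (hK i) => //; apply: contraNneq h => ->; rewrite mul0r.
have q2 : normc q ^+ 2 < 1 by rewrite expr_lt1 ?normc_ge0.
by apply: cvgc_crank_series; rewrite ?oner_neq0 ?normc1 ?mul1r.
Qed.

(** A positive b has at most b divisors, so sigma_j(b) <= b^(j+1) and the growth is polynomial. *)
Lemma subexponential_sigma_double j : subexponential (fun n => (sigma_double j n)%:R : R[i]).
Proof.
apply: (@subexponential_le _ _ (fun n => n.+1%:R ^+ j.+1)); last first.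
  by apply: subexponential_exp; exact: subexponential_natS.
move=> n; rewrite -natrX !normc_natr ler_nat /sigma_double.
case: ifP => // /andP[n0 on]; set b := n./2.
have b0 : (0 < b)%N by case: n n0 on @b => [|[|n]].
have bn : (b <= n)%N by rewrite /b -{2}(odd_double_half n) -addnn addnA leq_addl.
apply: (@leq_trans (b * b ^ j)); last first.
  by rewrite -expnS leq_exp2r // (leq_trans bn).
rewrite /sigma big_seq; apply: (@leq_trans (\sum_(d <- divisors b | d \in divisors b) b ^ j)).
  apply: leq_sum => d; rewrite -dvdn_divisors // => db.
  by case: (j) => // k; rewrite leq_exp2r // dvdn_leq.
rewrite -big_seq big_const_seq count_predT iter_addn_0 mulnC leq_mul2r; apply/orP; right.
rewrite -[leqRHS](size_iota 1); apply: uniq_leq_size; first exact: divisors_uniq.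
move=> d; rewrite -dvdn_divisors // mem_iota add1n ltnS => db.
by rewrite (dvdn_gt0 b0 db) dvdn_leq.
Qed.

(** In order 0 the series converges at q = 1 / t for every t > 1, so its terms there are bounded.
    Higher orders follow from the recurrence, a combination of convolutions of lower moments with
    divisor sums. *)
Lemma subexponential_moment r : subexponential (moment_coef r).
Proof.
elim/ltn_ind: r => -[_|r IH].
  move=> t t1; have t0 : 0 < t by lra.
  have nt : normc (t^-1%:C%C) = t^-1 by rewrite normc_real gtr0_norm ?invr_gt0.
  have [|B hB] := @cvgc_series_terms_bounded _ (fun n => moment_coef 0 n * t^-1%:C%C ^+ n) (C2bar 1 t^-1%:C%C).
    by apply: cvgc_moment0; rewrite nt invf_lt1.
  exists B => n; have := hB n; rewrite normcM normcX nt exprVn.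
  by rewrite ler_pdivrMr // exprn_gt0.
apply: (@subexponential_le _ _ (fun n => \sum_(j < r.+1) ('C(r, j)%:R * (1 - (-1) ^+ j)) *
   convolution (moment_coef (r - j)) (fun i => (sigma_double j i)%:R) n)).
  move=> n; rewrite moment_coef_rec exchange_big /= le_eqVlt; apply/orP; left; apply/eqP.
  congr normc; apply: eq_bigr => j _; rewrite /convolution mulr_sumr; apply: eq_bigr => i _.
  by rewrite mulrA.
apply: subexponential_sum => j; apply: subexponentialM; first exact: subexponential_cst.
apply: subexponential_convolution; last exact: subexponential_sigma_double.
by apply: IH; rewrite ltnS leq_subr.
Qed.

(** The coefficients at 0 and at odd indices vanish, so the first 2n + 1 terms in q add up to the
    first n terms in q^2. *)
Lemma cvgc_sigma_double j (q : R[i]) : normc q < 1 ->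
  cvgc (power_series (fun n => (sigma_double j n)%:R) q) (sigma_series j (q ^+ 2)).
Proof.
move=> q1; have [l hl] := cvgc_power_series (@subexponential_sigma_double j) q1.
suff -> : sigma_series j (q ^+ 2) = l by [].
apply: cvgc_lim; apply: (@cvgc_eq _ (power_series (fun n => (sigma_double j n)%:R) q \o (fun n => (2 * n).+1))).
  elim=> [|n IH].
    by rewrite /power_series /series /= big_nat1 big_geq // mul0r.
  have IH' : series (fun n => (sigma_double j n)%:R * q ^+ n) (2 * n).+1 =
    series (fun n => (sigma j n.+1)%:R * (q ^+ 2) ^+ n.+1) n := IH.
  rewrite /= mulnS !add2n /power_series (seriesSr _ (2 * n).+2) (seriesSr _ (2 * n).+1).
  rewrite [RHS]seriesSr IH' /sigma_double /= oddM /= mul0r addr0.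
  by rewrite !mul2n doubleK -exprM mul2n doubleS.
apply: (@cvgc_comp _ _ _ (fun n => (2 * n).+1)) hl => n.
by rewrite mul2n -addnn (leq_trans (leq_addr n n)).
Qed.

Definition moment_sum (r : nat) (q : R[i]) : R[i] :=
  @lim (R[i] : numFieldType) (power_series (moment_coef r) q @ \oo).

Lemma cvgc_moment_sum r (q : R[i]) : normc q < 1 ->
  cvgc (power_series (moment_coef r) q) (moment_sum r q).
Proof.
move=> q1; have [l hl] := cvgc_power_series (@subexponential_moment r) q1.
by rewrite /moment_sum (cvgc_lim hl).
Qed.

Lemma moment_sum0 (q : R[i]) : normc q < 1 -> moment_sum 0 q = C2bar 1 q.
Proof. by move=> q1; apply: cvgc_lim; exact: cvgc_moment0. Qed.

Lemma moment_sum_rec r (q : R[i]) : normc q < 1 ->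
  moment_sum r.+1 q = \sum_(j < r.+1) 'C(r, j)%:R * (1 - (-1) ^+ j) *
    (moment_sum (r - j) q * sigma_series j (q ^+ 2)).
Proof.
move=> q1; apply: cvgc_lim.
apply: (@cvgc_eq _ (fun N => \sum_(j < r.+1) ('C(r, j)%:R * (1 - (-1) ^+ j)) *
    power_series (convolution (moment_coef (r - j)) (fun i => (sigma_double j i)%:R)) q N)).
  move=> N; rewrite /power_series /series /=.
  under eq_bigr do rewrite mulr_sumr.
  rewrite exchange_big /=; apply: eq_bigr => n _; rewrite moment_coef_rec exchange_big /= mulr_suml.
  apply: eq_bigr => j _; rewrite /convolution mulrA mulr_sumr; congr (_ * _).
  by apply: eq_bigr => i _; rewrite mulrA.
apply: cvgc_sum => j; apply: cvgcZ; apply: cvgc_power_series_convolution => //.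
- exact: subexponential_moment.
- exact: subexponential_sigma_double.
- exact: cvgc_moment_sum.
- exact: cvgc_sigma_double.
Qed.

Lemma C2bar_momentE r (q : R[i]) : C2bar_moment M2 r q = moment_sum r q / C2bar 1 q.
Proof. by []. Qed.

Lemma C2bar_moment0 (q : R[i]) : normc q < 1 -> C2bar_moment M2 0 q = 1.
Proof. by move=> q1; rewrite C2bar_momentE moment_sum0 // divff // C2bar1_neq0. Qed.

Lemma sum_odd_terms (V : nmodType) (G : nat -> V) m : (forall k, G (2 * k)%N = 0) ->
  \sum_(j < 2 * m) G j = \sum_(k < m) G (2 * k).+1.
Proof.
move=> G0; elim: m => [|m IH]; first by rewrite !big_ord0.
by rewrite mulnS add2n 2!big_ord_recr [RHS]big_ord_recr /= IH G0 addr0.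
Qed.

(** The factor 1 - (-1)^j is 0 for even j and 2 for j = 2k + 1, so the even moments satisfy a
    recurrence among themselves. *)
Lemma C2bar_moment_rec n (q : R[i]) : normc q < 1 ->
  C2bar_moment M2 (2 * n.+1) q = \sum_(k < n.+1) 'C((2 * n).+1, (2 * k).+1)%:R * 2 *
    sigma_series (2 * k).+1 (q ^+ 2) * C2bar_moment M2 (2 * (n - k)) q.
Proof.
move=> q1; have e2 : (2 * n.+1)%N = (2 * n).+2 by rewrite mulnS.
rewrite C2bar_momentE e2.
rewrite moment_sum_rec // mulr_suml -[LHS](@big_mkord _ _ _ (2 * n).+2 xpredT (fun j =>
   'C((2 * n).+1, j)%:R * (1 - (-1) ^+ j) *
   (moment_sum ((2 * n).+1 - j) q * sigma_series j (q ^+ 2)) / C2bar 1 q)).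
rewrite -e2 big_mkord.
rewrite (@sum_odd_terms _ (fun j => 'C((2 * n).+1, j)%:R * (1 - (-1) ^+ j) *
   (moment_sum ((2 * n).+1 - j) q * sigma_series j (q ^+ 2)) / C2bar 1 q)); last first.
  by move=> k; rewrite [(-1) ^+ _]exprM sqrrN !expr1n subrr mulr0 !mul0r.
apply: eq_bigr => k _; rewrite C2bar_momentE subSS -mulnBr exprS exprM sqrrN expr1n.
by rewrite expr1n; ring.
Qed.

End CrankMoments.

(** * The nome on the upper half-plane *)

Section Nome.
Variable R : realType.

Lemma normc_cexp (z : R[i]) : normc (cexp z) = expR (complex.Re z).
Proof.
case: z => a b; rewrite /cexp /= !exprMn -mulrDr cos2Dsin2 mulr1 sqrtr_sqr.
by rewrite ger0_norm // expR_ge0.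
Qed.

Lemma nomeE (tau : R[i]) : 2 * Complex 0 pi * tau =
  Complex (- (2 * pi * complex.Im tau)) (2 * pi * complex.Re tau).
Proof.
case: tau => a b; rewrite -mulrA mulr_natl mulr2n; apply/eqP.
by rewrite eq_complex /=; apply/andP; split; apply/eqP; ring.
Qed.

Lemma normc_nome (tau : R[i]) : 0 < complex.Im tau -> normc (nome tau) < 1.
Proof.
move=> b0; rewrite normc_cexp -expR0 ltr_expR nomeE /= oppr_lt0.
by rewrite !mulr_gt0 // pi_gt0.
Qed.

Lemma nome_double (tau : R[i]) : nome (2 * tau) = nome tau ^+ 2.
Proof.
rewrite /nome mulrCA; set w := _ * tau.
have -> : 2 * w = w + w by rewrite mulr_natl mulr2n.
rewrite expr2; case: w => a b; rewrite /cexp; apply/eqP.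
rewrite eq_complex /= expRD cosD sinD; apply/andP; split; apply/eqP; ring.
Qed.

End Nome.

(** * The weights [PsiT] and [PsiV] *)

Section Traces.
Variable F : numFieldType.

(** With y_k = 2 x_k / (2k)!, each summand becomes (2s)! times the product of the y_k^(m_k) / m_k!,
    which [trace_exp] sums. *)
Lemma partition_trace_PsiT (s : nat) (x h : nat -> F) :
  h 0%N = 1 ->
  (forall n, h n.+1 *+ n.+1 =
     \sum_(k < n.+1) ((2 * x k.+1 / (2 * k.+1)`!%:R) *+ k.+1) * h (n - k)%N) ->
  partition_trace (@PsiT F s) x = (2 * s)`!%:R * h s.
Proof.
move=> h0 hrec.
rewrite -(trace_exp (y := fun k => 2 * x k / (2 * k)`!%:R) h0 hrec s) mulr_sumr.
apply: eq_bigr => m _; rewrite /PsiT -mulrA -big_split /=; congr (_ * _).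
apply: eq_bigr => i _; rewrite !exprMn exprVn invfM; ring.
Qed.

(** The powers of (2k)! in [PsiV] cancel those in the arguments, so [trace_log] yields y_s = 2 x_s /
    (2s)!; the prefactor (2s)! / 2 recovers x_s. *)
Lemma partition_trace_PsiV (s : nat) (x h : nat -> F) : (0 < s)%N ->
  h 0%N = 1 ->
  (forall n, h n.+1 *+ n.+1 =
     \sum_(k < n.+1) ((2 * x k.+1 / (2 * k.+1)`!%:R) *+ k.+1) * h (n - k)%N) ->
  partition_trace (@PsiV F s) (fun k => (2 * k)`!%:R * h k) = x s.
Proof.
move=> s0 h0 hrec.
have f0 n : (n`!%:R : F) != 0 by rewrite pnatr_eq0 -lt0n fact_gt0.
have n2 : (2 : F) != 0 by rewrite pnatr_eq0.
transitivity ((2 * s)`!%:R / 2 * (2 * x s / (2 * s)`!%:R)); last first.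
  by field; rewrite f0.
rewrite -(trace_log (y := fun k => 2 * x k / (2 * k)`!%:R) h0 hrec s0) mulr_sumr.
apply: eq_bigr => m _; rewrite /PsiV -!mulrA; do 4![congr (_ * _)].
rewrite -big_split /=; apply: eq_bigr => i _; rewrite exprMn.
have fi : (2 * i.+1)`!%:R ^+ m i != 0 :> F by rewrite expf_neq0.
by field; rewrite fi f0.
Qed.

End Traces.

(** * Specialisation to q = exp(2 pi i tau) *)

Unset Implicit Arguments.
Set Strict Implicit.
Set Printing Implicit Defensive.

Theorem theorem1p8 (R : realType) (M2 : int -> nat -> int)
    (hM2 : second_residual_crank_coef R[i] M2)
    (tau : R[i]) (htau : 0 < complex.Im tau) (s : nat) (hs : (1 <= s)%N) :
  C2bar_moment M2 (2 * s) (nome tau) =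
    partition_trace (@PsiT R[i] s)
      (fun k => eisenstein k (2 * tau) + bernoulli_term R k)
  /\
  eisenstein s (2 * tau) =
    - bernoulli_term R s +
    partition_trace (@PsiV R[i] s)
      (fun k => C2bar_moment M2 (2 * k) (nome tau)).
Proof.
have q1 := normc_nome htau; set q := nome tau in q1 *.
(* The truncated difference 2k - 1 is harmless, as the traces and the recurrence only involve k >=
   1. *)
pose x k := sigma_series (2 * k - 1) (q ^+ 2).
pose h k := C2bar_moment M2 (2 * k) q / (2 * k)`!%:R.
have f0 n : (n`!%:R : R[i]) != 0 by rewrite pnatr_eq0 -lt0n fact_gt0.
have hE k : C2bar_moment M2 (2 * k) q = (2 * k)`!%:R * h k.
  by rewrite /h mulrC divfK.
have h0 : h 0%N = 1 by rewrite /h muln0 (C2bar_moment0 hM2) // fact0 divr1.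
(* Dividing [C2bar_moment_rec] by (2n+2)! turns the binomial into inverse factorials. The factor n +
   1 cancels against 2n + 2 up to 1/2, and likewise k + 1 against the 2k + 2 in (2k+2)!. *)
have hrec n : h n.+1 *+ n.+1 =
    \sum_(k < n.+1) ((2 * x k.+1 / (2 * k.+1)`!%:R) *+ k.+1) * h (n - k)%N.
  rewrite {1}/h (C2bar_moment_rec hM2) // mulr_suml -sumrMnl; apply: eq_bigr => k _.
  have kn : (k <= n)%N by rewrite -ltnS.
  have -> : x k.+1 = sigma_series (2 * k).+1 (q ^+ 2) by rewrite /x mulnS add2n subn1.
  rewrite hE; set S := sigma_series _ _; set c := h _.
  have e1 : (2 * n.+1)`! = (2 * n.+1 * (2 * n).+1`!)%N by rewrite mulnS add2n factS.
  have e2 : (2 * k.+1)`! = (2 * k.+1 * (2 * k).+1`!)%N by rewrite mulnS add2n factS.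
  have e3 : ('C((2 * n).+1, (2 * k).+1) * ((2 * k).+1`! * (2 * (n - k))`!))%N = (2 * n).+1`!.
    have -> : (2 * (n - k) = (2 * n).+1 - (2 * k).+1)%N by rewrite subSS mulnBr.
    by rewrite bin_fact // ltnS leq_mul2l kn.
  rewrite -[LHS]mulr_natr -[X in _ = X * c]mulr_natr e1 e2 -e3 !natrM.
  have n0 j : (j.+1%:R : R[i]) != 0 by rewrite pnatr_eq0.
  have b0 : ('C((2 * n).+1, (2 * k).+1)%:R : R[i]) != 0.
    by rewrite pnatr_eq0 -lt0n bin_gt0 ltnS leq_mul2l kn.
  have := f0 (2 * k).+1; have := f0 (2 * (n - k))%N; have := n0 n; have := n0 k.
  have t0 : (2 : R[i]) != 0 by rewrite pnatr_eq0.
  move: b0 t0; move: ('C(_, _)%:R) ((2 * k).+1`!%:R) ((2 * (n - k))`!%:R) (n.+1%:R) (k.+1%:R) (2%:R) => u1 u2 u3 u4 u5 u6.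
  move=> *; field; do !(apply/andP; split) => //.
have eE k : eisenstein k (2 * tau) = - bernoulli_term R k + x k.
  by rewrite /eisenstein nome_double.
split.
  rewrite hE -(partition_trace_PsiT s h0 hrec); apply: eq_bigr => m _; congr (_ * _).
  (* The Bernoulli constants cancel, leaving the divisor series x_k as arguments. *)
  by apply: eq_bigr => i _; rewrite eE addrAC addNr add0r.
rewrite eE -(partition_trace_PsiV hs h0 hrec); congr (_ + _); apply: eq_bigr => m _; congr (_ * _).
by apply: eq_bigr => i _; rewrite hE.
Qed.
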